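(* Let $R$ be a semilocal commutative ring with $2\in R^\times$, let $(A,\sigma)$ be an Azumaya $R$-algebra with involution, let $\varepsilon\in Z(A)$ satisfy $\varepsilon^\sigma\varepsilon=1$, and let $(P,f)\in\mathcal H^\varepsilon(A,\sigma)$. Suppose that $P$ is a free $A$-module, and that $2\mid(\deg A)(\mathfrak p)$ for every $\mathfrak p\in\mathrm{Spec}\,R$ at which $(\sigma,\varepsilon)$ is symplectic. Then $(P,f)$ is diagonalizable.
   Context: Conventions. Rings are commutative and unital, algebras are unital and associative, and $2$ is invertible in all rings and algebras. Involutions are written $a\mapsto a^\sigma$; $Z(A)$ is the center. An Azumaya $R$-algebra with involution is a pair $(A,\sigma)$ where $A$ is an $R$-algebra and $\sigma$ is an $R$-linear involution such that $A$ is projective as an $R$-module and separable as an $R$-algebra (equivalently, $A$ is Azumaya over $Z(A)$ and $Z(A)$ is finite étale over $R$), and $r\mapsto r\cdot 1_A$ identifies $R$ with $\{z\in Z(A):z^\sigma=z\}$. $\deg A=\sqrt{\mathrm{rk}_{Z(A)}A}$, a function on $\mathrm{Spec}\,Z(A)$. $(\sigma,\varepsilon)$ is symplectic at $\mathfrak p\in\mathrm{Spec}\,R$ if the center of $A(\mathfrak p)=A\otimes_Rk(\mathfrak p)$ is $k(\mathfrak p)$ (so that $\varepsilon(\mathfrak p)=\pm1$) and either the induced involution $\sigma(\mathfrak p)$ is symplectic and $\varepsilon(\mathfrak p)=1$, or $\sigma(\mathfrak p)$ is orthogonal and $\varepsilon(\mathfrak p)=-1$. In that case $(\deg A)(\mathfrak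 p)$ is the degree of the central simple $k(\mathfrak p)$-algebra $A(\mathfrak p)$. $\mathcal H^\varepsilon(A,\sigma)$ is the category of unimodular $\varepsilon$-hermitian spaces: pairs $(P,f)$ with $P$ a finitely generated projective right $A$-module and $f:P\times P\to A$ biadditive with $f(xa,yb)=a^\sigma f(x,y)b$, $f(x,y)=\varepsilon f(y,x)^\sigma$ and $x\mapsto f(x,-):P\to\mathrm{Hom}_A(P,A)$ bijective. $(P,f)$ is diagonalizable if there are $m\ge 0$ and $a_1,\dots,a_m\in A$ with $a_i=\varepsilon a_i^\sigma$ such that $(P,f)$ is isometric to $A^m$ with the form $((x_i),(y_i))\mapsto\sum_ix_i^\sigma a_iy_i$. *)

(* Defs.v *)
From HB Require Import structures.
From mathcomp Require Import all_boot all_order all_algebra.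
From mathcomp Require Import boolp.

Set Implicit Arguments.
Unset Strict Implicit.
Unset Printing Implicit Defensive.

Import GRing.Theory.

Local Open Scope ring_scope.
Local Open Scope quotient_scope.

Section Tensor.
Variables (R : comNzRingType) (M N : lmodType R).
Implicit Types (s : seq (M * N)) (V : lmodType R).

Definition tensor_eval V (b : M -> N -> V) s : V := \sum_(u <- s) b u.1 u.2.

(* The sequence [:: (x1, y1); ...; (xn, yn)] stands for the formal sum of the
   xi ⊗ yi; two formal sums are equal in M ⊗ N exactly when no bilinear map
   separates them. *)
Definition tensor_equiv s (t : seq (M * N)) : bool :=
  `[< forall V (b : M -> N -> V), bilinear_for *:%R *:%R b ->
        tensor_eval b s = tensor_eval b t >].

Lemma tensor_equiv_class : equiv_class_of tensor_equiv.
Proof.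
split=> [s|s t|t s u]; first by apply/asboolP.
  by apply: asbool_equiv_eq; split=> st V b bb; rewrite st.
by move=> /asboolP st /asboolP tu; apply/asboolP => V b bb; rewrite st ?tu.
Qed.

Canonical tensor_equiv_equiv := EquivRelPack tensor_equiv_class.
Canonical tensor_equiv_encModRel := defaultEncModRel tensor_equiv.

Definition tensor := {eq_quot tensor_equiv}.
HB.instance Definition _ : EqQuotient _ tensor_equiv tensor :=
  EqQuotient.on tensor.
HB.instance Definition _ := Choice.on tensor.
Implicit Types t : tensor.

Definition tensor_lift V (b : M -> N -> V) (t : tensor) : V :=
  tensor_eval b (repr t).

Definition tens (x : M) (y : N) : tensor := \pi_tensor [:: (x, y)].

Definition tensor_opp_seq s := [seq (- u.1, u.2) | u <- s].
Definition tensor_scale_seq (r : R) s := [seq (r *: u.1, u.2) | u <- s].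

Definition tensor_zero : tensor := \pi_tensor [::].
Definition tensor_add t (u : tensor) : tensor := \pi_tensor (repr t ++ repr u).
Definition tensor_opp t : tensor :=
  \pi_tensor (tensor_opp_seq (repr t)).
Definition tensor_scale (r : R) t : tensor :=
  \pi_tensor (tensor_scale_seq r (repr t)).

Lemma tensor_lift_pi V (b : M -> N -> V) s : bilinear_for *:%R *:%R b ->
  tensor_lift b (\pi_tensor s) = tensor_eval b s.
Proof.
move=> bb; have /eqmodP/asboolP := reprK (\pi_tensor s); exact.
Qed.

Lemma tensorP t (u : tensor) :
  (forall V (b : M -> N -> V), bilinear_for *:%R *:%R b ->
     tensor_lift b t = tensor_lift b u) -> t = u.
Proof.
by move=> tu; rewrite -[t]reprK -[u]reprK; apply/eqmodP/asboolP => V b /tu.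
Qed.

Section Bilinear.
Variables (V : lmodType R) (b : M -> N -> V).
Hypothesis bb : bilinear_for *:%R *:%R b.

Lemma bilinear0l y : b 0 y = 0.
Proof. by have /= := bb.1 y (-1) 0 0; rewrite scaler0 addr0 scaleN1r addNr. Qed.

Lemma bilinearZl r x y : b (r *: x) y = r *: b x y.
Proof. by have := bb.1 y r x 0; rewrite addr0 bilinear0l addr0. Qed.

Lemma tensor_lift_tens x y : tensor_lift b (tens x y) = b x y.
Proof. by rewrite tensor_lift_pi // /tensor_eval big_seq1. Qed.

Lemma tensor_lift0 : tensor_lift b tensor_zero = 0.
Proof. by rewrite tensor_lift_pi // /tensor_eval big_nil. Qed.

Lemma tensor_liftD t u :
  tensor_lift b (tensor_add t u) = tensor_lift b t + tensor_lift b u.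
Proof. by rewrite tensor_lift_pi // /tensor_eval big_cat. Qed.

Lemma tensor_liftZ r t :
  tensor_lift b (tensor_scale r t) = r *: tensor_lift b t.
Proof.
rewrite tensor_lift_pi // /tensor_eval big_map scaler_sumr.
by apply: eq_bigr => u _ /=; rewrite bilinearZl.
Qed.

Lemma tensor_liftN t : tensor_lift b (tensor_opp t) = - tensor_lift b t.
Proof.
rewrite tensor_lift_pi // /tensor_eval big_map -sumrN.
by apply: eq_bigr => u _ /=; rewrite -scaleN1r bilinearZl scaleN1r.
Qed.

End Bilinear.

Let liftE := (tensor_liftD, tensor_liftN, tensor_liftZ, tensor_lift0).

Fact tensor_addA : associative tensor_add.
Proof. by move=> t u v; apply: tensorP => V b bb; rewrite !liftE // addrA. Qed.

Fact tensor_addC : commutative tensor_add.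
Proof. by move=> t u; apply: tensorP => V b bb; rewrite !liftE // addrC. Qed.

Fact tensor_add0 : left_id tensor_zero tensor_add.
Proof. by move=> t; apply: tensorP => V b bb; rewrite !liftE // add0r. Qed.

Fact tensor_addN : left_inverse tensor_zero tensor_opp tensor_add.
Proof. by move=> t; apply: tensorP => V b bb; rewrite !liftE // addNr. Qed.

HB.instance Definition _ := GRing.isZmodule.Build tensor
  tensor_addA tensor_addC tensor_add0 tensor_addN.

Fact tensor_scaleA r q t :
  tensor_scale r (tensor_scale q t) = tensor_scale (r * q) t.
Proof. by apply: tensorP => V b bb; rewrite !liftE // scalerA. Qed.

Fact tensor_scale1 : left_id 1 tensor_scale.
Proof. by move=> t; apply: tensorP => V b bb; rewrite !liftE // scale1r. Qed.

Fact tensor_scaleDr : right_distributive tensor_scale +%R.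
Proof.
move=> r t u; apply: tensorP => V b bb.
by rewrite !liftE // scalerDr.
Qed.

Fact tensor_scaleDl t : {morph tensor_scale^~ t : r q / r + q}.
Proof. by move=> r q; apply: tensorP => V b bb; rewrite !liftE // scalerDl. Qed.

HB.instance Definition _ := GRing.Zmodule_isLmodule.Build R tensor
  tensor_scaleA tensor_scale1 tensor_scaleDr tensor_scaleDl.

Lemma tensor_lift_is_linear V (b : M -> N -> V) :
  bilinear_for *:%R *:%R b -> linear (tensor_lift b).
Proof. by move=> bb r t u; rewrite tensor_liftD // tensor_liftZ. Qed.

Lemma tens_bilinear : bilinear_for *:%R *:%R tens.
Proof.
split=> [y r x x'|x r y y'] /=; apply: tensorP => V b bb;
  rewrite tensor_lift_is_linear // !tensor_lift_tens //.
- exact: bb.1.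
- exact: bb.2.
Qed.

Lemma tensorE t : t = \sum_(u <- repr t) tens u.1 u.2.
Proof.
apply: tensorP => V b bb; rewrite /tensor_lift [LHS]/tensor_eval.
elim: (repr t) => [|u s IHs]; first by rewrite !big_nil; apply/esym/tensor_lift0.
by rewrite !big_cons IHs -(tensor_lift_tens bb); apply/esym/tensor_liftD.
Qed.

Lemma tensor_ind (P : tensor -> Prop) :
    P 0 -> (forall x y t, P t -> P (tens x y + t)) ->
  forall t, P t.
Proof.
move=> P0 PD t; rewrite [t]tensorE.
by elim: (repr t) => [|u s IHs]; rewrite ?big_nil // big_cons; apply: PD.
Qed.

Lemma tensor_ext V (f g : tensor -> V) : linear f -> linear g ->
  (forall x y, f (tens x y) = g (tens x y)) -> f =1 g.
Proof.
have lin0 (h : tensor -> V) : linear h -> h 0 = 0.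
  by move=> lh; have := lh (-1) 0 0; rewrite scaler0 addr0 scaleN1r addNr.
move=> fl gl fg; elim/tensor_ind => [|x y t IHt]; first by rewrite !lin0.
by rewrite -[tens x y]scale1r fl gl fg IHt.
Qed.

End Tensor.

Section TensorAlgebra.
Variables (R : comNzRingType) (A B : algType R).
Implicit Types t : tensor A B.

Definition tensor_mul t (u : tensor A B) : tensor A B :=
  tensor_lift (fun a b =>
    tensor_lift (fun a' b' => tens (a * a') (b * b')) u) t.

Lemma tensor_mul_bilinear_in a b : bilinear_for *:%R *:%R
  (fun a' b' => tens (a * a') (b * b') : tensor A B).
Proof.
split=> [b' r x x'|a' r y y'] /=; rewrite mulrDr -scalerAr.
  exact: (tens_bilinear _ _).1.
exact: (tens_bilinear _ _).2.
Qed.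

Lemma tensor_mul_bilinear_out u : bilinear_for *:%R *:%R (fun a b =>
  tensor_lift (fun a' b' => tens (a * a') (b * b') : tensor A B) u).
Proof.
rewrite /tensor_lift /tensor_eval.
split=> [b r x x'|a r y y'] /=; rewrite scaler_sumr -big_split /=;
  apply: eq_bigr => v _; rewrite mulrDl -scalerAl.
  exact: (tens_bilinear _ _).1.
exact: (tens_bilinear _ _).2.
Qed.

Lemma tensor_mul_tens a b a' b' :
  tensor_mul (tens a b) (tens a' b') = tens (a * a') (b * b').
Proof.
rewrite /tensor_mul tensor_lift_tens; last exact: tensor_mul_bilinear_out.
by rewrite tensor_lift_tens //; apply: tensor_mul_bilinear_in.
Qed.

Lemma tensor_mul_linearl u : linear (tensor_mul^~ u).
Proof. exact/tensor_lift_is_linear/tensor_mul_bilinear_out. Qed.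

Lemma tensor_mul_linearr t : linear (tensor_mul t).
Proof.
move=> r u v; rewrite /tensor_mul [in LHS]/tensor_lift /tensor_eval.
rewrite [X in _ = _ *: X + _]/tensor_lift [X in _ = _ + X]/tensor_lift.
rewrite /tensor_eval scaler_sumr -big_split /=; apply: eq_bigr => w _.
exact/tensor_lift_is_linear/tensor_mul_bilinear_in.
Qed.

Fact tensor_mulA : associative tensor_mul.
Proof.
move=> t u v; move: t; apply: tensor_ext => [||a b].
- exact: tensor_mul_linearl.
- by move=> r x y; rewrite !tensor_mul_linearl.
move: u; apply: tensor_ext => [||a' b'].
- by move=> r x y; rewrite tensor_mul_linearl tensor_mul_linearr.
- by move=> r x y; rewrite tensor_mul_linearr tensor_mul_linearl.
move: v; apply: tensor_ext => [||a'' b''].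
- by move=> r x y; rewrite !tensor_mul_linearr.
- exact: tensor_mul_linearr.
by rewrite !tensor_mul_tens !mulrA.
Qed.

Fact tensor_mul1l : left_id (tens 1 1) tensor_mul.
Proof.
apply: tensor_ext => [||a b]; [exact: tensor_mul_linearr | by [] |].
by rewrite tensor_mul_tens !mul1r.
Qed.

Fact tensor_mul1r : right_id (tens 1 1) tensor_mul.
Proof.
apply: tensor_ext => [||a b]; [exact: tensor_mul_linearl | by [] |].
by rewrite tensor_mul_tens !mulr1.
Qed.

Fact tensor_mulDl : left_distributive tensor_mul +%R.
Proof. by move=> t u v; have := tensor_mul_linearl v 1 t u; rewrite !scale1r. Qed.

Fact tensor_mulDr : right_distributive tensor_mul +%R.
Proof. by move=> t u v; have := tensor_mul_linearr t 1 u v; rewrite !scale1r. Qed.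

HB.instance Definition _ := GRing.Zmodule_isPzRing.Build (tensor A B)
  tensor_mulA tensor_mul1l tensor_mul1r tensor_mulDl tensor_mulDr.

Lemma tensM a b a' b' :
  (tens a b : tensor A B) * tens a' b' = tens (a * a') (b * b').
Proof. exact: tensor_mul_tens. Qed.

Definition tens_inr (b : B) : tensor A B := tens 1 b.

Fact tens_inr_is_zmod_morphism : zmod_morphism tens_inr.
Proof.
move=> x y; have /= := (tens_bilinear A B).2 1 (-1) y x.
by rewrite !scaleN1r => tensB; rewrite /tens_inr addrC tensB addrC.
Qed.

Fact tens_inr_is_monoid_morphism : monoid_morphism tens_inr.
Proof. by split=> // x y; rewrite /tens_inr tensM mulr1. Qed.

HB.instance Definition _ :=
  GRing.isZmodMorphism.Build B (tensor A B) tens_inr tens_inr_is_zmod_morphism.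
HB.instance Definition _ := GRing.isMonoidMorphism.Build B (tensor A B)
  tens_inr tens_inr_is_monoid_morphism.

Definition tensor_map_left (f : A -> A) : tensor A B -> tensor A B :=
  tensor_lift (fun a b => tens (f a) b).

End TensorAlgebra.

Section Converse.
Variables (R : comNzRingType) (A : algType R).

Let scale (r : R) (a : A^c) : A^c := r *: (a : A).
Fact converse_scaleA r q a : scale r (scale q a) = scale (r * q) a.
Proof. exact: scalerA. Qed.
Fact converse_scale1 : left_id 1 scale. Proof. exact: scale1r. Qed.
Fact converse_scaleDr : right_distributive scale +%R.
Proof. exact: scalerDr. Qed.
Fact converse_scaleDl a : {morph scale^~ a : r q / r + q}.
Proof. by move=> r q; apply: scalerDl. Qed.
HB.instance Definition _ := GRing.Zmodule_isLmodule.Build R A^c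
  converse_scaleA converse_scale1 converse_scaleDr converse_scaleDl.

Fact converse_scaleAl (r : R) (a b : A^c) : r *: (a * b) = (r *: a) * b.
Proof. exact: (scalerAr r (b : A) (a : A)). Qed.
Fact converse_scaleAr (r : R) (a b : A^c) : r *: (a * b) = a * (r *: b).
Proof. exact: (scalerAl r (b : A) (a : A)). Qed.
HB.instance Definition _ :=
  GRing.Lmodule_isLalgebra.Build R A^c converse_scaleAl.
HB.instance Definition _ :=
  GRing.Lalgebra_isAlgebra.Build R A^c converse_scaleAr.

End Converse.

(* A as a left A ⊗ A^op-module, (a ⊗ b) x = a x b. *)
Definition enveloping_module (R : comNzRingType) (A : algType R) : Type := A.

Section EnvelopingModule.
Variables (R : comNzRingType) (A : algType R).
Local Notation Ae := (tensor A A^c).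
Local Notation M := (enveloping_module A).
HB.instance Definition _ := GRing.Zmodule.on M.

Definition enveloping_scale (t : Ae) (x : M) : M :=
  tensor_lift (fun (a : A) (b : A^c) => a * (x : A) * (b : A)) t.

Lemma enveloping_bilinear (x : A) : bilinear_for *:%R *:%R
  (fun (a : A) (b : A^c) => a * (x : A) * (b : A)).
Proof.
split=> [b r a a'|a r b b'] /=; first by rewrite !mulrDl -!scalerAl.
by rewrite mulrDr scalerAr.
Qed.

Lemma enveloping_scale_linear (x : A) :
  linear (enveloping_scale^~ x : Ae -> A).
Proof. exact/tensor_lift_is_linear/enveloping_bilinear. Qed.

Lemma enveloping_scale_tens (a : A) (b : A^c) (x : A) :
  enveloping_scale (tens a b) x = a * x * (b : A).
Proof. exact/(tensor_lift_tens (enveloping_bilinear x)). Qed.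

Fact enveloping_scaleDl x : {morph enveloping_scale^~ x : t u / t + u}.
Proof.
by move=> t u; have := enveloping_scale_linear x 1 t u; rewrite !scale1r.
Qed.

Fact enveloping_scaleDr : right_distributive enveloping_scale +%R.
Proof.
move=> t x y; rewrite /enveloping_scale /tensor_lift /tensor_eval.
by rewrite -big_split; apply: eq_bigr => u _ /=; rewrite mulrDr mulrDl.
Qed.

Fact enveloping_scale1 : left_id 1 enveloping_scale.
Proof. by move=> x; rewrite [LHS]enveloping_scale_tens mul1r mulr1. Qed.

Fact enveloping_scaleZr (r : R) (t : Ae) (x : A) :
  enveloping_scale t (r *: x) = r *: (enveloping_scale t x : A).
Proof.
rewrite /enveloping_scale /tensor_lift /tensor_eval scaler_sumr.
by apply: eq_bigr => u _ /=; rewrite -scalerAr -scalerAl.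
Qed.

Fact enveloping_scaleA t u x :
  enveloping_scale t (enveloping_scale u x) = enveloping_scale (t * u) x.
Proof.
move: t; apply: (@tensor_ext _ _ _ A) => [||a b].
- by move=> r t v; rewrite enveloping_scale_linear.
- by move=> r t v; rewrite -enveloping_scale_linear -tensor_mul_linearl.
move: u; apply: (@tensor_ext _ _ _ A) => [||a' b'].
- move=> r u v; rewrite enveloping_scale_linear enveloping_scaleDr.
  by rewrite enveloping_scaleZr.
- by move=> r u v; rewrite -enveloping_scale_linear -tensor_mul_linearr.
by rewrite tensM !enveloping_scale_tens !mulrA.
Qed.

HB.instance Definition _ := GRing.Zmodule_isLmodule.Build Ae M
  enveloping_scaleA enveloping_scale1 enveloping_scaleDr enveloping_scaleDl.

End EnvelopingModule.

Section ResidueField.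
Variables (R : comNzRingType) (p : prime_idealr R).

Definition residue_ring : Type := {ideal_quot p}.
HB.instance Definition _ := GRing.ComNzRing.on residue_ring.

Definition residue_ring_unit (x : residue_ring) : bool :=
  `[< exists y, y * x = 1 >].
Definition residue_ring_inv (x : residue_ring) : residue_ring :=
  if pselect (exists y, y * x = 1) is left ex then projT1 (cid ex) else x.

Fact residue_ring_mulVr :
  {in residue_ring_unit, left_inverse 1 residue_ring_inv *%R}.
Proof.
by move=> x /asboolP ex; rewrite /residue_ring_inv; case: pselect => // ex';
   case: (cid ex').
Qed.

Fact residue_ring_unitPl (x y : residue_ring) : y * x = 1 -> residue_ring_unit x.
Proof. by move=> yx1; apply/asboolP; exists y. Qed.

Fact residue_ring_invr_out : {in [predC residue_ring_unit], residue_ring_inv =1 id}.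
Proof.
by move=> x /asboolPn nex; rewrite /residue_ring_inv; case: pselect.
Qed.

HB.instance Definition _ := GRing.ComNzRing_hasMulInverse.Build residue_ring
  residue_ring_mulVr residue_ring_unitPl residue_ring_invr_out.
HB.instance Definition _ := GRing.ComUnitRing_isIntegral.Build residue_ring
  (@Quotient.rquot_IdomainAxiom R p).

Definition residue_field : Type := {fraction residue_ring}.
HB.instance Definition _ := GRing.Field.on residue_field.

Definition to_residue_field (r : R) : residue_field :=
  FracField.tofrac (\pi_{ideal_quot p} r : residue_ring).

Fact to_residue_field_is_zmod_morphism : zmod_morphism to_residue_field.
Proof. by move=> x y; rewrite /to_residue_field !rmorphB. Qed.

Fact to_residue_field_is_monoid_morphism : monoid_morphism to_residue_field.
Proof.
by split=> [|x y]; rewrite /to_residue_field ?rmorph1 ?rmorphM.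
Qed.

HB.instance Definition _ := GRing.isZmodMorphism.Build R residue_field
  to_residue_field to_residue_field_is_zmod_morphism.
HB.instance Definition _ := GRing.isMonoidMorphism.Build R residue_field
  to_residue_field to_residue_field_is_monoid_morphism.

Definition residue_field_scale (r : R) (x : residue_field) : residue_field :=
  to_residue_field r * x.

Fact residue_field_scaleA r q x :
  residue_field_scale r (residue_field_scale q x) = residue_field_scale (r * q) x.
Proof. by rewrite /residue_field_scale rmorphM mulrA. Qed.
Fact residue_field_scale1 : left_id 1 residue_field_scale.
Proof. by move=> x; rewrite /residue_field_scale rmorph1 mul1r. Qed.
Fact residue_field_scaleDr : right_distributive residue_field_scale +%R.
Proof. by move=> r x y; apply: mulrDr. Qed.
Fact residue_field_scaleDl x : {morph residue_field_scale^~ x : r q / r + q}.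
Proof. by move=> r q; rewrite /residue_field_scale rmorphD mulrDl. Qed.
HB.instance Definition _ := GRing.Zmodule_isLmodule.Build R residue_field
  residue_field_scaleA residue_field_scale1
  residue_field_scaleDr residue_field_scaleDl.

Fact residue_field_scaleAl (r : R) (x y : residue_field) :
  r *: (x * y) = (r *: x) * y.
Proof. exact: mulrA. Qed.
Fact residue_field_scaleAr (r : R) (x y : residue_field) :
  r *: (x * y) = x * (r *: y).
Proof. exact: mulrCA. Qed.
HB.instance Definition _ :=
  GRing.Lmodule_isLalgebra.Build R residue_field residue_field_scaleAl.
HB.instance Definition _ :=
  GRing.Lalgebra_isAlgebra.Build R residue_field residue_field_scaleAr.

End ResidueField.

Definition maximal_ideal (R : comNzRingType) (m : idealr R) : Prop :=
  forall I : idealr R, {subset m <= I} -> {subset I <= m}.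

Definition semilocal (R : comNzRingType) : Prop :=
  exists n (m : 'I_n -> idealr R),
    forall I : idealr R, maximal_ideal I -> exists i, m i =i I.

Section Modules.
Variables (S : pzRingType) (M : lmodType S).

Definition finitely_generated : Prop :=
  exists n (e : 'I_n -> M), forall x, exists c : 'I_n -> S,
    x = \sum_i c i *: e i.

Definition projective_module : Prop :=
  forall (N N' : lmodType S) (g : {linear N -> N'}) (h : {linear M -> N'}),
    (forall y, exists x, g x = y) ->
  exists h' : {linear M -> N}, forall x, g (h' x) = h x.

Definition free_module : Prop :=
  exists (I : eqType) (e : I -> M),
    (forall x, exists (s : seq I) (c : I -> S), x = \sum_(i <- s) c i *: e i) /\
    (forall (s : seq I) (c : I -> S), uniq s ->
       \sum_(i <- s) c i *: e i = 0 -> {in s, forall i, c i = 0}).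

End Modules.

Definition in_center (B : pzRingType) (z : B) : Prop := forall b, z * b = b * z.

Definition separable_algebra (R : comNzRingType) (A : algType R) : Prop :=
  projective_module (enveloping_module A).

Record azumaya_with_involution (R : comNzRingType) (A : algType R)
    (sigma : {linear A -> A}) : Prop := AzumayaWithInvolution {
  azumaya_invM : forall a b, sigma (a * b) = sigma b * sigma a;
  azumaya_invK : involutive sigma;
  azumaya_projective : projective_module A;
  azumaya_separable : separable_algebra A;
  azumaya_inj : injective (fun r : R => r%:A : A);
  azumaya_fixed_center : forall z : A,
    in_center z /\ sigma z = z <-> exists r : R, z = r%:A
}.

(* A K-algebra B is given here by its structure map i : K -> B, as the fibers
   of A, not known a priori to be nonzero, need not be of type algType. *)

Section CentralSimple.

Definition algebra_basis (K B : pzRingType) (i : {rmorphism K -> B})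
    (m : nat) (e : 'I_m -> B) : Prop :=
  forall b, exists! c : {ffun 'I_m -> K}, b = \sum_j i (c j) * e j.

Definition algebra_central (K B : pzRingType) (i : {rmorphism K -> B}) : Prop :=
  injective i /\ forall z, in_center z <-> exists c, z = i c.

Definition algebra_degree (K B : pzRingType) (i : {rmorphism K -> B})
    (d : nat) : Prop :=
  exists e : 'I_(d ^ 2)%N -> B, algebra_basis i e.

Variables (K : fieldType) (B : pzRingType) (i : {rmorphism K -> B}).

(* The morphism induced by rho from the scalar extension of B along psi to
   'M[L]_n is an isomorphism of L-algebras: the scalar extension of B has the
   L-basis (e_j ⊗ 1), which that morphism sends to the family (rho (e_j)). *)
Definition splitting (L : fieldType) (psi : {rmorphism K -> L})
    (n : nat) (rho : {rmorphism B -> 'M[L]_n}) : Prop :=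
  (forall c, rho (i c) = (psi c)%:M) /\
  exists m (e : 'I_m -> B), algebra_basis i e /\
    algebra_basis (@scalar_mx L n : {rmorphism L -> 'M[L]_n}) (rho \o e).

Definition alternating (L : fieldType) (n : nat) (g : 'M[L]_n) : Prop :=
  forall v : 'cV[L]_n, v^T *m g *m v = 0.

(* The scalar extension of tau to some splitting field is the involution
   adjoint to a nonsingular alternating bilinear form, of Gram matrix g. *)
Definition symplectic_involution (tau : B -> B) : Prop :=
  exists (L : fieldType) (psi : {rmorphism K -> L}) (n : nat)
    (rho : {rmorphism B -> 'M[L]_n}) (g : 'M[L]_n),
    [/\ splitting psi rho, g \in unitmx, alternating g
      & forall b, (rho (tau b))^T *m g = g *m rho b].

(* For K-linear involutions of central simple K-algebras only: there, orthogonal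
   means not symplectic, and the choice of the splitting is immaterial. *)
Definition orthogonal_involution (tau : B -> B) : Prop :=
  ~ symplectic_involution tau.

End CentralSimple.

Section SymplecticAt.
Variables (R : comNzRingType) (A : algType R) (p : prime_idealr R).

Local Notation fiber := (tensor A (residue_field p)).

Definition fiber_scalar : {rmorphism residue_field p -> fiber} :=
  @tens_inr R A (residue_field p).

Definition symplectic_at (sigma : {linear A -> A}) (eps : A) : Prop :=
  algebra_central fiber_scalar /\
  (symplectic_involution fiber_scalar (tensor_map_left sigma) /\
     tens eps 1 = 1 :> fiber \/
   orthogonal_involution fiber_scalar (tensor_map_left sigma) /\
     tens eps 1 = -1 :> fiber).

Definition even_degree_at : Prop :=
  exists2 d, algebra_degree fiber_scalar d & (2 %| d)%N.

End SymplecticAt.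

(* A right A-module is a left module over the converse ring A^c: the product
   of x by a on the right is (a : A^c) *: x. *)

Section Hermitian.
Variables (R : comNzRingType) (A : algType R) (sigma : {linear A -> A}).
Variables (eps : A) (P : lmodType A^c) (f : P -> P -> A).

Record unimodular_hermitian : Prop := UnimodularHermitian {
  herm_finitely_generated : finitely_generated P;
  herm_projective : projective_module P;
  herm_addl : forall x x' y, f (x + x') y = f x y + f x' y;
  herm_addr : forall x y y', f x (y + y') = f x y + f x y';
  herm_sesqui : forall x y (a b : A),
    f ((a : A^c) *: x) ((b : A^c) *: y) = sigma a * f x y * b;
  herm_sym : forall x y, f x y = eps * sigma (f y x);
  herm_unimodular : forall phi : {linear P -> (A^c)^o},
    exists! x, forall y, f x y = phi y
}.

Definition diagonal_form (m : nat) (a : 'I_m -> A)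
    (x y : {ffun 'I_m -> (A^c)^o}) : A :=
  \sum_i sigma (x i : A) * a i * (y i : A).

Definition diagonalizable_form : Prop :=
  exists (m : nat) (a : 'I_m -> A),
    (forall i, a i = eps * sigma (a i)) /\
    exists phi : {linear P -> {ffun 'I_m -> (A^c)^o}},
      bijective phi /\ forall x y, diagonal_form a (phi x) (phi y) = f x y.

End Hermitian.

(* Main.v *)
(* Over a semilocal ring it suffices to find, for a nondegenerate family
   e_0, ..., e_n, a vector x in e_0 + span(e_1, ..., e_n) with f(x, x)
   invertible: x, e_1, ..., e_n then span the same module and the orthogonal
   projection of e_1, ..., e_n along x is again nondegenerate.  By the Chinese
   remainder theorem and Nakayama's lemma, x may be sought in the fibers of A at
   the maximal ideals of R.

   In a fiber B (semisimple, with Z(B)^tau = K) choose x so that a = f(x, x) has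
   maximal rank, with aB = (1 - e)B for an idempotent e.  A Schur complement
   computation shows that, if e <> 0, no perturbation of x raises the rank only
   if every element of e B tau(e) is skew with respect to (tau, eps).  This
   forces Z(B) = K and eBe = Ke, so that B = M_n(K) and tau is adjoint to a form
   on Be of the opposite symmetry: (tau, eps) is symplectic.  Moreover a is then
   an alternating matrix of corank 1, so n is odd, against the hypothesis. *)

Require Import Defs.
From HB Require Import structures.
From mathcomp Require Import all_boot all_order all_algebra.
From mathcomp Require Import boolp.
From mathcomp Require classical_sets freeg.

Set Implicit Arguments.
Unset Strict Implicit.
Unset Printing Implicit Defensive.

Import GRing.Theory.
Local Open Scope ring_scope.

(** * Matrices over a field *)

(** The degree hypothesis answers a genuine obstacle: for [A = R] with trivial involution and
    [eps = -1], every [f x x] vanishes. A failure of invertibility must therefore be tied to a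
    parity.

    The hermitian module is never reduced modulo a maximal ideal. Only the set of values [f x x] on
    the coset passes to the fiber, with one property: for each value [a] there are [u], [d], [c]
    with [a * c + u = 1] such that [a + u b + eps tau(u b) + tau(b) d b] is again a value for every
    [b]. The relation between [a] and [u] comes from nondegeneracy; it lets the perturbation reach
    the part of [B] that [a] misses.

    Skewness of the corner comes from comparing [b] with [-b]: the Schur complement is the sum of a
    part additive in [b] and a quadratic part, it must vanish for both signs, and 2 is invertible.

    No classification of semisimple algebras is invoked. A separability idempotent makes every
    element von Neumann regular; this gives idempotent generators of ideals, then simplicity and
    matrix units, hence an explicit splitting over [K] itself. *)

Lemma unitmx_ker (K : fieldType) n (M : 'M[K]_n) :
  (forall v : 'cV_n, M *m v = 0 -> v = 0) -> M \in unitmx.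
Proof.
move=> inj; rewrite -unitmx_tr -row_free_unit -kermx_eq0.
apply/eqP/row_matrixP => i; rewrite row0; apply: (can_inj trmxK); rewrite trmx0.
by apply: inj; rewrite -{1}[M]trmxK -trmx_mul -row_mul mulmx_ker row0 trmx0.
Qed.

Lemma skew_alternating (K : fieldType) n (M : 'M[K]_n) :
  2%:R != 0 :> K -> M^T = - M -> alternating M.
Proof.
move=> K2 MT v; have : (v^T *m M *m v)^T = - (v^T *m M *m v).
  by rewrite !trmx_mul trmxK MT mulNmx mulmxN mulmxA.
move=> /matrixP/(_ 0 0); rewrite !mxE => /eqP; rewrite -addr_eq0 -mulr2n.
rewrite -mulr_natl mulf_eq0 (negPf K2) => /eqP vMv.
by apply/matrixP => i j; rewrite !ord1 !mxE.
Qed.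

(** Border [M] by a coordinate vector on which [v0] does not vanish. The bordered matrix is skew of
    size [n + 1] and invertible, which is impossible when [n + 1] is odd. *)
Lemma skew_corank1_odd (K : fieldType) n (M : 'M[K]_n) (v0 : 'cV_n) :
    2%:R != 0 :> K -> M^T = - M -> v0 != 0 -> M *m v0 = 0 ->
    (forall v : 'cV_n, M *m v = 0 -> exists l, v = l *: v0) -> odd n.
Proof.
move=> K2 MT v0n0 Mv0 ker; apply: contraT => even_n.
have [i vi] : exists i, v0 i 0 != 0.
  by case/cV0Pn: v0n0 => i vi; exists i.
pose w : 'rV[K]_n := delta_mx 0 i.
pose M' : 'M[K]_(n + 1) := block_mx M w^T (- w) 0.
have M'T : M'^T = - M'.
  by rewrite tr_block_mx opp_block_mx MT trmxK trmx0 oppr0 opprK linearN.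
have : \det M' = - \det M'.
  by rewrite -{1}det_tr M'T -scaleN1r detZ -signr_odd oddD addbT even_n mulN1r.
move/eqP; rewrite -addr_eq0 -mulr2n -mulr_natl mulf_eq0 (negPf K2) /=.
suff /negPf-> : \det M' != 0 by [].
rewrite -unitfE -unitmxE; apply: unitmx_ker => u; rewrite -[u]vsubmxK.
set x := usubmx u; set y := dsubmx u.
rewrite mul_block_col mul0mx addr0 -[0]vsubmxK => /eq_col_mx[Mx wx].
rewrite !linear0 in Mx wx.
have y0 : y = 0.
  have := congr1 (mulmx v0^T) Mx; rewrite mulmx0 mulmxDr.
  rewrite !mulmxA -[v0^T *m M]trmxK trmx_mul trmxK MT mulNmx Mv0 oppr0 trmx0.
  rewrite mul0mx add0r -trmx_mul => /matrixP/(_ 0 0).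
  rewrite mxE big_ord1 [_ 0 0]mxE -rowE mxE [RHS]mxE => /eqP.
  rewrite mulf_eq0 (negPf vi) => /eqP y0.
  by apply/matrixP => j k; rewrite !ord1 y0 mxE.
move: Mx; rewrite y0 mulmx0 addr0 => /ker[l xl].
have l0 : l = 0.
  move: wx; rewrite xl mulNmx -scalemxAr -rowE => /eqP; rewrite oppr_eq0.
  move=> /eqP/matrixP/(_ 0 0); rewrite !mxE => /eqP.
  by rewrite mulf_eq0 (negPf vi) orbF => /eqP.
by rewrite xl l0 scale0r !linear0.
Qed.

(** A row relation of the matrix expressing [e] in [e'] would give a second expansion of 0 in [e].
    This makes the degree of an algebra well defined. *)
Lemma algebra_basis_leq (K : fieldType) (B : pzRingType) (i : {rmorphism K -> B})
    m m' (e : 'I_m -> B) (e' : 'I_m' -> B) :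
  algebra_basis i e -> algebra_basis i e' -> (m <= m')%N.
Proof.
move=> be be'.
pose c j := projT1 (cid (be' (e j))).
have cE j : e j = \sum_k i (c j k) * e' k.
  by rewrite /c; case: cid => x [].
pose M : 'M[K]_(m, m') := \matrix_(j, k) c j k.
suff /eqP <- : row_free M by exact: rank_leq_col.
rewrite -kermx_eq0; apply/eqP/row_matrixP => r; rewrite row0.
suff inj (v : 'rV_m) : v *m M = 0 -> v = 0.
  by apply: inj; rewrite -row_mul mulmx_ker row0.
move=> vM.
have [x [_ xu]] := be 0.
have zero : 0 = \sum_j i ([ffun=> 0] j : K) * e j.
  by rewrite big1 // => j _; rewrite ffunE rmorph0 mul0r.
have vzero : 0 = \sum_j i ([ffun j => v 0 j] j) * e j.
  under eq_bigr do rewrite ffunE cE mulr_sumr.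
  rewrite exchange_big big1 //= => k _.
  under eq_bigr do rewrite mulrA -rmorphM.
  rewrite -mulr_suml -rmorph_sum /=.
  have /matrixP/(_ 0 k) := vM; rewrite !mxE => vMk.
  suff -> : \sum_(j < m) v 0 j * c j k = 0 by rewrite rmorph0 mul0r.
  by rewrite -[RHS]vMk; apply: eq_bigr => j _; rewrite mxE.
apply/matrixP => a j; rewrite ord1 [RHS]mxE.
have /ffunP/(_ j) : [ffun j => v 0 j] = [ffun=> 0].
  by rewrite -(xu _ zero) -(xu _ vzero).
by rewrite !ffunE.
Qed.

(** * Separable algebras with involution over a field *)

Section SeparableFiniteAlgebra.
Variables (K : fieldType) (B : pzRingType) (iota : {rmorphism K -> B}).
Hypothesis iotaC : forall c b, iota c * b = b * iota c.

Variables (N : nat) (crd : 'I_N -> B -> K) (gen : 'I_N -> B).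
Hypothesis crdD : forall j b b', crd j (b + b') = crd j b + crd j b'.
Hypothesis crdZ : forall j c b, crd j (iota c * b) = c * crd j b.
Hypothesis crd_gen : forall b, b = \sum_j iota (crd j b) * gen j.

Variables (nsep : nat) (sepl sepr : 'I_nsep -> B).
Hypothesis sep1 : \sum_i sepl i * sepr i = 1.
(** The identity [(b ⊗ 1) s = s (1 ⊗ b)] for the separability idempotent [s], tested only on
    bilinear maps of the form [(u, v) ↦ F u * v]. This avoids tensor products over [K]. *)
Hypothesis sepC : forall F : B -> B,
  (forall b b', F (b + b') = F b + F b') ->
  (forall c b, F (iota c * b) = iota c * F b) ->
  forall b, \sum_i F (b * sepl i) * sepr i = \sum_i F (sepl i) * sepr i * b.

Lemma crd0 j : crd j 0 = 0.
Proof. by have := crdZ j 0 0; rewrite mulr0 mul0r. Qed.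

Lemma crd_sum j n (F : 'I_n -> B) : crd j (\sum_i F i) = \sum_i crd j (F i).
Proof. exact: (big_morph _ (crdD j) (crd0 j)). Qed.

(* [gen] is only a generating family with dual [crd], not a basis, so [leftmx] is
   multiplicative but [leftmx 1] is a mere idempotent. *)
Definition leftmx (b : B) : 'M[K]_N := \matrix_(i, j) crd i (b * gen j).

Lemma leftmxM b b' : leftmx (b * b') = leftmx b *m leftmx b'.
Proof.
apply/matrixP => i j; rewrite !mxE.
under eq_bigr do rewrite !mxE mulrC -crdZ.
rewrite -crd_sum -mulrA [in LHS](crd_gen (b' * gen j)) mulr_sumr; congr (crd i _).
by apply: eq_bigr => k _; rewrite mulrA -iotaC mulrA.
Qed.

Lemma leftmx0 : leftmx 0 = 0.
Proof. by apply/matrixP => i j; rewrite !mxE mul0r crd0. Qed.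

Lemma leftmx_eq0 b : leftmx b = 0 -> b = 0.
Proof.
move=> b0; rewrite -[b]mulr1 [1](crd_gen 1) mulr_sumr big1 // => j _.
rewrite mulrA -iotaC -mulrA [b * gen j]crd_gen big1 ?mulr0 // => i _.
by have /matrixP/(_ i j) := b0; rewrite !mxE => ->; rewrite rmorph0 mul0r.
Qed.

(** This is the [K]-dimension of the right ideal [bB]: combining the [gen j] is surjective onto [B]
    and taking coordinates [crd] is injective. *)
Definition leftrk b := \rank (leftmx b).

Lemma leftrk_le b : (leftrk b <= N)%N.
Proof. exact: rank_leq_row. Qed.

Lemma leftrk_mull b b' : (leftrk (b * b') <= leftrk b')%N.
Proof. by rewrite /leftrk leftmxM mxrankM_maxr. Qed.

Lemma leftrk_mulr b b' : (leftrk (b * b') <= leftrk b)%N.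
Proof. by rewrite /leftrk leftmxM mxrankM_maxl. Qed.

(** Left multiplication by [p] maps [yB] onto [pyB] and kills the nonzero element [y * v]. The
    transposes turn this kernel into one of row vectors. *)
Lemma leftrk_lt (p y v : B) : p * (y * v) = 0 -> y * v <> 0 ->
  (leftrk (p * y) < leftrk y)%N.
Proof.
move=> pyv0 yvn0; rewrite /leftrk leftmxM -mxrank_tr trmx_mul.
rewrite -[X in (_ < X)%N]mxrank_tr -(mxrank_mul_ker (leftmx y)^T (leftmx p)^T).
rewrite -[X in (X < _)%N]addn0 ltn_add2l lt0n mxrank_eq0.
apply: contra_notN yvn0 => /eqP cap0; apply: leftmx_eq0.
apply: (can_inj trmxK); apply/eqP; rewrite trmx0 -submx0 -cap0 sub_capmx.
rewrite leftmxM trmx_mul submxMl; apply/sub_kermxP.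
by rewrite -!trmx_mul -!leftmxM pyv0 leftmx0 trmx0.
Qed.

(* Averaging a linear generalized inverse of the left multiplication by [a] over
   the separability idempotent makes it right linear. *)
Lemma vonneumann_regular (a : B) : exists t, a * t * a = a.
Proof.
pose dec (v : 'cV[K]_N) : B := \sum_j iota (v j 0) * gen j.
pose cod b : 'cV[K]_N := \col_j crd j b.
have decD u v : dec (u + v) = dec u + dec v.
  by rewrite -big_split; apply: eq_bigr => j _; rewrite mxE rmorphD mulrDl.
have decZ c v : dec (c *: v) = iota c * dec v.
  by rewrite /dec mulr_sumr; apply: eq_bigr => j _; rewrite mxE rmorphM mulrA.
have codD u v : cod (u + v) = cod u + cod v.
  by apply/matrixP => i j; rewrite !mxE crdD.
have codZ c v : cod (iota c * v) = c *: cod v.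
  by apply/matrixP => i j; rewrite !mxE crdZ.
have codK b : dec (cod b) = b.
  by rewrite [RHS]crd_gen; apply: eq_bigr => j _; rewrite mxE.
have leftE v : leftmx a *m v = cod (a * dec v).
  apply/matrixP => i j; rewrite ord1 !mxE mulr_sumr crd_sum; apply: eq_bigr => k _.
  by rewrite !mxE mulrA -iotaC -mulrA crdZ mulrC.
pose S b := dec (pinvmx (leftmx a) *m cod b).
have SD b b' : S (b + b') = S b + S b' by rewrite /S codD mulmxDr decD.
have SZ c b : S (iota c * b) = iota c * S b by rewrite /S codZ -scalemxAr decZ.
have aS b : a * S (a * b) = a * b.
  rewrite -[LHS]codK -leftE -[in cod _](codK b) -leftE mulmxA mulmxA.
  by rewrite mulmxKpV ?submx_refl // leftE !codK.
exists (\sum_i S (sepl i) * sepr i); rewrite -mulrA mulr_suml -(sepC SD SZ) mulr_sumr.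
under eq_bigr do rewrite mulrA aS -mulrA.
by rewrite -mulr_sumr sep1 mulr1.
Qed.

Definition right_ideal (I : B -> Prop) :=
  [/\ I 0, forall x y, I x -> I y -> I (x + y) & forall x b, I x -> I (x * b)].

(** Enlarge an idempotent of [I] until it fixes [I]. If [w'] in [I] is nonzero and killed by [g0],
    regularity gives an idempotent [h = w' * t] with [g0 * h = 0]; multiplying by [1 - g0] makes it
    orthogonal to [g0] on both sides, and [g0 + h'] has larger rank. *)
Lemma right_ideal_idempotent (I : B -> Prop) : right_ideal I ->
  exists g0, [/\ I g0, g0 * g0 = g0 & forall w, I w -> g0 * w = w].
Proof.
move=> [I0 ID IM].
suff H n g0 : I g0 -> g0 * g0 = g0 -> (N - leftrk g0 < n)%N ->
    exists g0, [/\ I g0, g0 * g0 = g0 & forall w, I w -> g0 * w = w].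
  by apply: (H _ 0 I0 _ (ltnSn _)); rewrite mulr0.
elim: n g0 => // n IHn g0 Ig gg; rewrite ltnS => lt_n.
have IN x : I x -> I (- x) by move=> /(IM _ (-1)); rewrite mulrN1.
have [all_fix|/existsNP[w /not_implyP[Iw /eqP gw]]] :=
  pselect (forall w, I w -> g0 * w = w); first by exists g0.
pose w' := w - g0 * w.
have w'n0 : w' != 0 by rewrite subr_eq0 eq_sym.
have gw' : g0 * w' = 0 by rewrite mulrBr mulrA gg subrr.
have Iw' : I w' by apply: ID => //; apply: IN; apply: IM.
have [t wtw] := vonneumann_regular w'.
pose h := w' * t; pose h' := h * (1 - g0).
have gh : g0 * h = 0 by rewrite mulrA gw' mul0r.
have hh : h * h = h by rewrite /h mulrA wtw.
have h'g : h' * g0 = 0 by rewrite -mulrA mulrBl mul1r gg subrr mulr0.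
have gh' : g0 * h' = 0 by rewrite mulrA gh mul0r.
have h'h : h' * h = h by rewrite -mulrA mulrBl mul1r gh subr0.
have h'h' : h' * h' = h' by rewrite {2}/h' mulrA h'h.
have h'n0 : h' <> 0.
  by move=> h'0; move: w'n0; rewrite -wtw -/h -h'h h'0 !mul0r eqxx.
have Ih' : I h' by do 2! apply: (IM).
have lt_rk : (leftrk g0 < leftrk (g0 + h'))%N.
  have -> : leftrk g0 = leftrk (g0 * (g0 + h')) by rewrite mulrDr gg gh' addr0.
  by apply: (@leftrk_lt _ _ h'); rewrite mulrDl gh' add0r h'h' ?gh'.
apply: (IHn (g0 + h')); first exact: ID.
  by rewrite mulrDl !mulrDr gg gh' h'g h'h' addr0 add0r.
apply: leq_trans lt_n; apply: ltn_sub2l => //; apply: leq_trans lt_rk _.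
exact: rank_leq_row.
Qed.

(** For [w] in [I], the defect [v = w * (1 - g0)] satisfies [v = v * t * v], and [1 - g0] kills
    [t * v], which lies in [I]. So [g0] is also a right identity of [I], and
    [g0 * b = g0 * b * g0 = b * g0]. *)
Lemma ideal_central_idempotent (I : B -> Prop) : right_ideal I ->
    (forall x b, I x -> I (b * x)) ->
  exists g0, [/\ I g0, g0 * g0 = g0, in_center g0 & forall w, I w -> g0 * w = w].
Proof.
move=> rI lI; have [g0 [Ig gg gw]] := right_ideal_idempotent rI.
exists g0; split=> //; have [I0 ID IM] := rI.
have wg w : I w -> w * g0 = w.
  move=> Iw; apply/esym/eqP; rewrite -subr_eq0; apply/eqP; set v := (w - _).
  have [t vtv] := vonneumann_regular v.
  have vE : v = w * (1 - g0) by rewrite mulrBr mulr1.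
  have Iv : I v by rewrite vE; exact: IM.
  by rewrite -vtv {1}vE -!mulrA mulrBl mul1r gw ?subrr ?mulr0 //; exact: lI.
by move=> b; rewrite -(wg _ (IM _ b Ig)) -mulrA gw //; exact: lI.
Qed.

Definition span2 (c : B) (w : B) : Prop :=
  exists n, exists p q : 'I_n -> B, w = \sum_i p i * c * q i.

Lemma span2_ideal c : right_ideal (span2 c).
Proof.
split.
- by exists 0, (fun=> 0), (fun=> 0); rewrite big_ord0.
- move=> _ _ [n [p [q ->]]] [m [p' [q' ->]]].
  exists (n + m)%N, (fun i => match split i with inl j => p j | inr j => p' j end),
    (fun i => match split i with inl j => q j | inr j => q' j end).
  rewrite big_split_ord /=; congr (_ + _); apply: eq_bigr => i _.
    by rewrite (unsplitK (inl i)).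
  by rewrite (unsplitK (inr i)).
- move=> _ b [n [p [q ->]]]; exists n, p, (fun i => q i * b).
  by rewrite mulr_suml; apply: eq_bigr => i _; rewrite mulrA.
Qed.

Lemma span2_left c x b : span2 c x -> span2 c (b * x).
Proof.
move=> [n [p [q ->]]]; exists n, (fun i => b * p i), q.
by rewrite mulr_sumr; apply: eq_bigr => i _; rewrite !mulrA.
Qed.

Lemma span2_self c : span2 c c.
Proof. by exists 1, (fun=> 1), (fun=> 1); rewrite big_ord1 mul1r mulr1. Qed.

(** The central idempotent generating [BcB] is a nonzero scalar, hence invertible. *)
Lemma simple_of_central : algebra_central iota ->
  forall c, c <> 0 -> span2 c 1.
Proof.
move=> [iinj cent] c cn0.
have [g0 [Ig gg cg gw]] := ideal_central_idempotent (span2_ideal c)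
  (@span2_left c).
have [k gE] := (cent g0).1 cg.
have kn0 : k != 0.
  apply: contra_notN cn0 => /eqP k0.
  by rewrite -(gw _ (span2_self c)) gE k0 rmorph0 mul0r.
by have := span2_left (iota k^-1) Ig; rewrite gE -rmorphM mulVf // rmorph1.
Qed.

Variables (tau : B -> B) (eps : B).
Hypothesis tauD : forall a b, tau (a + b) = tau a + tau b.
Hypothesis tauM : forall a b, tau (a * b) = tau b * tau a.
Hypothesis tauK : involutive tau.
Hypothesis tau_iota : forall c, tau (iota c) = iota c.
Hypothesis tau_fixed : forall z, in_center z -> tau z = z -> exists c, z = iota c.
Hypothesis epsC : in_center eps.
Hypothesis epsV : tau eps * eps = 1.
Hypothesis two_neq0 : 2%:R != 0 :> K.

Lemma tau1 : tau 1 = 1. Proof. by rewrite -(rmorph1 iota) tau_iota. Qed.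
Lemma tau0 : tau 0 = 0. Proof. by rewrite -(rmorph0 iota) tau_iota. Qed.
Lemma tauN b : tau (- b) = - tau b.
Proof. by apply/eqP; rewrite -addr_eq0 -tauD addNr tau0. Qed.

Lemma double_eq0 (b : B) : b + b = 0 -> b = 0.
Proof.
move=> bb; have : iota 2%:R^-1 * (iota 2%:R * b) = 0.
  by rewrite -[2%:R]/(1 + 1 : K) rmorphD rmorph1 mulrDl mul1r bb mulr0.
by rewrite mulrA -rmorphM mulVf // rmorph1 mul1r.
Qed.

(** * Raising the rank of a hermitian element by a perturbation *)

Section Perturbation.
Variables (a t : B).
Hypothesis a_herm : a = eps * tau a.
Hypothesis ata : a * t * a = a.
Let e2 := a * t.
Let e := 1 - e2.

Lemma pert_tau_a : tau a = tau eps * a.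
Proof. by rewrite {2}a_herm mulrA epsV mul1r. Qed.

Lemma pert_e2e2 : e2 * e2 = e2. Proof. by rewrite /e2 mulrA ata. Qed.
Lemma pert_e2e : e2 * e = 0. Proof. by rewrite mulrBr mulr1 pert_e2e2 subrr. Qed.
Lemma pert_ee : e * e = e. Proof. by rewrite {1}/e mulrBl mul1r pert_e2e subr0. Qed.
Lemma pert_ea : e * a = 0. Proof. by rewrite mulrBl mul1r ata subrr. Qed.
Lemma pert_ate : a * tau e = 0.
Proof. by rewrite a_herm -mulrA -tauM pert_ea tau0 mulr0. Qed.
Lemma pert_tete : tau e * tau e = tau e. Proof. by rewrite -tauM pert_ee. Qed.

(** Since [tau a = tau eps * a], the idempotent [tau e2 = tau t * tau a] kills whatever [a]
    kills. *)
Lemma pert_ker z : a * z = 0 -> z = tau e * z.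
Proof.
move=> az; rewrite /e tauD tau1 tauN mulrBl mul1r /e2 tauM pert_tau_a.
by rewrite -!mulrA az !mulr0 subr0.
Qed.

(* With respect to the idempotents [e2] and [e], the perturbed form has corner
   [a], and [s] below is its Schur complement. *)
Lemma pert_rank (u b d : B) : e * u = e ->
  let z := u * b * tau e in
  let M := a + z + eps * tau z + tau (b * tau e) * d * (b * tau e) in
  let s := e * b * tau e + eps * tau (e * b * tau e)
           + tau (b * tau e) * d * (b * tau e)
           - eps * tau z * (tau e2 * t * e2) * z in
  s <> 0 -> (leftrk a < leftrk M)%N.
Proof.
move=> eu z M; set q := tau _ * d * _; set p := tau e2 * t * e2; move=> s sn0.
have ez : e * z = e * b * tau e by rewrite /z !mulrA eu.
have zte : z * tau e = z by rewrite /z -mulrA pert_tete.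
have etz : e * tau z = tau z by rewrite -{2}zte tauM tauK.
have e2z : e2 * tau z = 0 by rewrite -etz mulrA pert_e2e mul0r.
have qte : q * tau e = q by rewrite /q -!mulrA pert_tete.
have e_q : e * q = q by rewrite /q tauM tauK !mulrA pert_ee.
have e2q : e2 * q = 0 by rewrite -e_q mulrA pert_e2e mul0r.
have p_e : p * e = 0 by rewrite /p -mulrA pert_e2e mulr0.
have tep : tau e * p = 0.
  rewrite /p !mulrA -tauM pert_e2e tau0 !mul0r //.
(* As [a * tau e = 0], the factor [tau e2] of [p] does not affect [a * p]. It is there to have
   [tau e * p = 0], so that [p] inverts [a] between the corners and ignores the perturbation
   terms. *)
have ap : a * p = e2.
  have -> : p = tau (1 - e) * (t * e2) by rewrite subKr [p]/(_ * _) mulrA.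
  rewrite tauD tauN tau1 mulrA mulrBr pert_ate mulr1 subr0.
  by rewrite mulrA -/e2 pert_e2e2.
have zp : z * p = 0 by rewrite -zte -mulrA tep mulr0.
have qp : q * p = 0 by rewrite -qte -mulrA tep mulr0.
have ptz : p * tau z = 0 by rewrite -etz mulrA p_e mul0r.
have pq : p * q = 0 by rewrite -e_q mulrA p_e mul0r.
have pa : p * a * tau e = 0 by rewrite -mulrA pert_ate mulr0.
have epsA x y : x * (eps * y) = eps * (x * y) by rewrite mulrA -epsC mulrA.
have Mte : M * tau e = z + eps * tau z * tau e + q.
  by rewrite /M !mulrDl pert_ate add0r zte qte.
have pMte : p * (M * tau e) = p * z.
  by rewrite Mte !mulrDr -mulrA epsA (mulrA p) ptz mul0r mulr0 pq !addr0.
have e2M : e2 * M = a + e2 * z.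
  by rewrite /M !mulrDr e2q epsA e2z mulr0 !addr0 /e2 ata.
(* A column operation on [M], so the rank does not grow. It gives [e2 * y = a] and [y * tau e = s];
   as [e2] kills [s <> 0], the rank of [a] is less than that of [y]. *)
pose y := M - M * p * (M * tau e).
have -> : a = e2 * y.
  rewrite mulrBr -[M * p * _]mulrA pMte [in RHS]mulrA e2M mulrA.
  rewrite mulrDl mulrDl ap -(mulrA e2 z p) zp mulr0 mul0r addr0.
  by rewrite addrK.
have sE : s = z - e2 * z + eps * tau z * tau e + q - eps * tau z * p * z.
  have <- : e * z = z - e2 * z by rewrite mulrBl mul1r.
  by rewrite /s -ez [tau (e * z)]tauM [eps * (_ * _)]mulrA.
have yte : y * tau e = s.
  rewrite mulrBl -(mulrA (M * p)) -(mulrA M (tau e)) pert_tete.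
  rewrite -(mulrA M p) pMte Mte /M mulrA !mulrDl qp ap zp mul0r addr0 addr0.
  by rewrite sE opprD !addrA; congr (_ - _); rewrite [LHS]addrAC [in LHS](addrAC z).
have e2s : e2 * s = 0.
  have e2x x : e2 * (eps * tau z * x) = 0.
    by rewrite -[eps * _ * x]mulrA epsA [e2 * (_ * _)]mulrA e2z mul0r mulr0.
  have -> : s = e * z + eps * tau z * tau e + q - eps * tau z * (p * z).
    by rewrite sE [eps * tau z * (p * z)]mulrA [e * z]mulrBl mul1r.
  by rewrite mulrBr !mulrDr !e2x e2q subr0 !addr0 [LHS]mulrA pert_e2e mul0r.
have lt_y : (leftrk (e2 * y) < leftrk y)%N.
  by apply: (@leftrk_lt _ _ (tau e)); rewrite yte.
apply: leq_trans lt_y _.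
have -> : y = M * (1 - p * (M * tau e)) by rewrite mulrBr mulr1 mulrA.
exact: leftrk_mulr.
Qed.

End Perturbation.

(* [S] stands for the values [f(x, x)] on a coset [x0 + W], and [u = f(x, w)],
   [d = f(w, w)] for some [w] in [W], so that [S] is asked to contain the value
   at [x + w b]. *)
Lemma unit_or_skew (S : B -> Prop) (a0 : B) : S a0 ->
    (forall a, S a -> a = eps * tau a) ->
    (forall a, S a -> exists u d c, a * c + u = 1 /\
       forall b, S (a + u * b + eps * tau (u * b) + tau b * d * b)) ->
  (exists a, S a /\ exists a', a * a' = 1 /\ a' * a = 1) \/
  exists a t, let e := 1 - a * t in
    [/\ a = eps * tau a, a * t * a = a, e <> 0 &
        forall b, e * b * tau e = - (eps * tau (e * b * tau e))].
Proof.
move=> Sa0 Sherm Spert.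
have [a [Sa amax]] : exists a, S a /\ forall a', S a' -> (leftrk a' <= leftrk a)%N.
  apply: contrapT => noMax.
  suff H n a : S a -> (N - leftrk a < n)%N -> False by exact: H _ _ Sa0 (ltnSn _).
  elim: n a => // n IHn a Sa; rewrite ltnS => le_n; apply: noMax.
  exists a; split=> //.
  move=> a' Sa'; rewrite leqNgt; apply/negP => lt_a; apply: (IHn _ Sa').
  by apply: leq_trans le_n; rewrite ltn_sub2l // (leq_trans lt_a) ?leftrk_le.
have [t ata] := vonneumann_regular a; have ah := Sherm _ Sa.
have [e0|en0] := pselect (1 - a * t = 0).
  left; exists a; split=> //; exists t.
  have at1 : a * t = 1 by apply/esym/eqP; rewrite -subr_eq0 e0.
  split=> //; have t'a : tau t * tau eps * a = 1.
    by rewrite -mulrA -(pert_tau_a ah) -tauM at1 tau1.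
  move: (tau t * tau eps) t'a => t' t'a.
  have tt' : t' = t by rewrite -[LHS]mulr1 -at1 mulrA t'a mul1r.
  by rewrite -tt'.
right; exists a, t => e; split=> // b.
have [u [d [c [acu Su]]]] := Spert a Sa.
have eu : e * u = e.
  by rewrite -[RHS]mulr1 -acu mulrDr [e * (a * c)]mulrA (pert_ea ata) mul0r add0r.
set z := u * b * tau e.
set q := tau (b * tau e) * d * (b * tau e).
set p := tau (a * t) * t * (a * t).
set D := e * b * tau e + eps * tau (e * b * tau e).
have s1 : D + (q - eps * tau z * p * z) = 0.
  apply: contrapT; rewrite addrA => /(pert_rank ah ata eu); rewrite ltnNge.
  by case/negP; apply: amax; rewrite -(mulrA u).
(* Same argument for [- b]: [D] changes sign while the two quadratic terms do not. *)
have s2 : - D + (q - eps * tau z * p * z) = 0.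
  have := @pert_rank a t ah ata u (- b) d eu; rewrite /= -/e.
  rewrite !(mulNr, mulrN, tauN, opprK) -/z -/q -/p -opprD -/D -addrA => H.
  apply: contrapT => /H; rewrite ltnNge => /negP; apply; apply: amax.
  have := Su (- (b * tau e)).
  by rewrite !(mulNr, mulrN, tauN, opprK) (mulrA u).
apply/eqP; rewrite -addr_eq0; apply/eqP/double_eq0.
by have := subrr (0 : B); rewrite -{1}s1 -{1}s2 opprD opprK addrACA subrr addr0.
Qed.

(** * A skew corner forces a split symplectic algebra of odd degree *)

Section SkewCorner.
Variables (a e : B).
Hypothesis a_herm : a = eps * tau a.
Hypothesis ee : e * e = e.
Hypothesis ea : e * a = 0.
Hypothesis ker_a : forall z, a * z = 0 -> z = tau e * z.
Hypothesis e_neq0 : e <> 0.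
Hypothesis skew : forall b, e * b * tau e = - (eps * tau (e * b * tau e)).

Lemma tau_e_idem : tau e * tau e = tau e. Proof. by rewrite -tauM ee. Qed.

Lemma iota_inj : injective iota.
Proof.
apply: raddf_inj => c /eqP ic0; apply/eqP; apply: contra_notT e_neq0 => cn0.
by rewrite -[e]mul1r -(rmorph1 iota) -(mulVf cn0) rmorphM (eqP ic0) mulr0 mul0r.
Qed.

Lemma tau_center z : in_center z -> in_center (tau z).
Proof. by move=> cz b; rewrite -(tauK b) -!tauM cz. Qed.

(* Otherwise the two-sided ideal of [e] is generated by a central idempotent [z]
   with [z + tau z = 1], and [a * z + tau z] is both regular and killed by [e]. *)
Lemma corner_neq0 : exists b, e * b * tau e <> 0.
Proof.
apply: contrapT => /forallNP corner0.
have {}corner0 b : e * b * tau e = 0 by apply: contrapT; apply: corner0.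
have [z [[n [p [q zE]]] zz cz zw]] :=
  ideal_central_idempotent (span2_ideal e) (@span2_left e).
have ze : z * e = e := zw _ (span2_self e).
have zte : z * tau e = 0.
  rewrite zE mulr_suml big1 // => i _.
  by rewrite -[p i * _ * _]mulrA -mulrA corner0 mulr0.
have ztz : z * tau z = 0.
  have -> : tau z = \sum_i tau (q i) * tau e * tau (p i).
    rewrite zE (big_morph tau tauD tau0); apply: eq_bigr => i _.
    by rewrite !tauM mulrA.
  rewrite mulr_sumr big1 // => i _.
  by rewrite !mulrA cz -(mulrA _ z) zte mulr0 mul0r.
have ctz : in_center (tau z) by exact: tau_center.
have tzz : tau z * tau z = tau z by rewrite -tauM zz.
have tzz0 : tau z * z = 0 by rewrite ctz.
have z1 : z + tau z = 1.
  have [c cE] : exists c, z + tau z = iota c.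
    apply: tau_fixed; first by move=> b; rewrite mulrDl mulrDr cz ctz.
    by rewrite tauD tauK addrC.
  have idem : (z + tau z) * (z + tau z) = z + tau z.
    by rewrite mulrDl !mulrDr zz tzz ztz tzz0 addr0 add0r.
  have : c * c = c by apply: iota_inj; rewrite rmorphM -cE.
  have [c0 _|cn0 /(canRL (mulKf cn0))] := eqVneq c 0; last first.
    by rewrite mulVf // => c1; rewrite cE c1 rmorph1.
  case: e_neq0; rewrite -ze; suff -> : z = 0 by rewrite mul0r.
  by have := mulrDr z z (tau z); rewrite cE c0 rmorph0 mulr0 zz ztz addr0.
pose m := a * z + tau z.
have em : e * m = 0.
  rewrite mulrDr mulrA ea mul0r add0r -ze -mulrA -ctz mulrA ztz mul0r //.
have m_reg x : m * x = 0 -> x = 0.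
  move=> mx.
  have tzx : tau z * x = 0.
    have := congr1 ( *%R (tau z)) mx; rewrite mulr0 mulrA mulrDr tzz.
    by rewrite ctz -mulrA ztz mulr0 add0r.
  have zx : z * x = 0.
    have azx : a * (z * x) = 0.
      by have := mx; rewrite mulrDl tzx addr0 mulrA.
    by rewrite (ker_a azx) mulrA -cz zte mul0r.
  by rewrite -[x]mul1r -z1 mulrDl zx tzx addr0.
have [m' mm'm] := vonneumann_regular m.
have m'm : m' * m = 1.
  apply/eqP; rewrite -subr_eq0; apply/eqP/m_reg.
  by rewrite mulrBr mulrA mm'm mulr1 subrr.
(* Left invertibility gives [m] the rank of 1, but [m] lies in [(1 - e)B], whose rank is smaller
   because [e <> 0]. *)
have mE : m = (1 - e) * m by rewrite mulrBl em mul1r subr0.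
have e0 : (1 - e) * (1 * e) = 0 by rewrite mul1r mulrBl mul1r ee subrr.
have := @leftrk_lt _ _ _ e0; rewrite mul1r mulr1 => /(_ e_neq0).
rewrite ltnNge => /negP; apply.
have /leq_trans := leftrk_mull m' m; rewrite m'm; apply.
by rewrite mE; apply: leftrk_mulr.
Qed.

(** Multiplying by a skew central [y] exchanges skew and symmetric elements, yet preserves the
    corner; so [y] kills the corner. Its square is a scalar, nonzero by regularity if [y <> 0],
    which would make the corner zero. Applied to [z - tau z], this excludes involutions moving the
    center. *)
Lemma skew_central_eq0 y : in_center y -> tau y = - y -> y = 0.
Proof.
move=> cy ty; apply: contrapT => yn0; have [b] := corner_neq0; apply.
have [k kE] : exists k, y * y = iota k.
  apply: tau_fixed; last by rewrite tauM ty mulNr mulrN opprK.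
  by move=> x; rewrite -mulrA cy -mulrA cy -mulrA.
have kn0 : k != 0.
  apply: contra_notN yn0 => /eqP k0; have [y' <-] := vonneumann_regular y.
  by rewrite cy -mulrA kE k0 rmorph0 mulr0.
set c := e * b * tau e.
have yc : y * c = 0.
  apply: double_eq0.
  have ycE : y * c = e * (b * y) * tau e.
    by rewrite cy /c -[LHS]mulrA -(cy (tau e)) !mulrA.
  have := skew (b * y); rewrite -ycE tauM ty mulrN mulrN opprK => {1}->.
  by rewrite mulrA -cy [c in X in _ + X]skew mulrN addrN.
by rewrite -[c]mul1r -(rmorph1 iota) -(mulVf kn0) rmorphM -kE -!mulrA yc !mulr0.
Qed.

Lemma skew_corner_central : algebra_central iota.
Proof.
split; first exact: iota_inj.
move=> z; split=> [cz|[c ->] b]; last exact: iotaC.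
apply: tau_fixed => //; apply/esym/eqP; rewrite -subr_eq0; apply/eqP.
have ctz := tau_center cz.
apply: skew_central_eq0; last by rewrite tauD tauN tauK opprB.
by move=> b; rewrite mulrBl mulrBr cz ctz.
Qed.

Let central : algebra_central iota := skew_corner_central.

(** Simplicity writes 1 as an element of [ByB]; multiply by [x]. *)
Lemma simple_prime (x y : B) : (forall b, x * b * y = 0) -> x = 0 \/ y = 0.
Proof.
move=> xBy; have [->|yn0] := pselect (y = 0); first by right.
left; have [m [p [q one]]] := simple_of_central central yn0.
rewrite -[x]mulr1 one mulr_sumr big1 // => i _.
by rewrite 2!mulrA xBy mul0r.
Qed.

Lemma tau_e_neq0 : tau e <> 0.
Proof. by move=> te0; apply: e_neq0; rewrite -(tauK e) te0 tau0. Qed.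

Lemma eps_sign : eps = 1 \/ eps = -1.
Proof.
have [k kE] := (central.2 eps).1 epsC.
have kk : k * k = 1.
  by apply: iota_inj; rewrite rmorphM rmorph1 -epsV kE tau_iota.
have /eqP := subr_sqr_1 k; rewrite expr2 kk subrr eq_sym mulf_eq0.
by case/orP; rewrite ?subr_eq0 ?addr_eq0 => /eqP k1;
  [left | right]; rewrite kE k1 ?rmorphN1 ?rmorph1.
Qed.

Lemma eps_eps : eps * eps = 1.
Proof. by case: eps_sign => ->; rewrite ?mulr1 ?mulrNN ?mulr1. Qed.

Lemma corner_skew c : e * c = c -> c * tau e = c -> tau c = - (eps * c).
Proof.
move=> ec cte; have := skew c; rewrite ec cte => {2}->.
by rewrite mulrN mulrA eps_eps mul1r opprK.
Qed.

(* For [c] in the corner [e B tau(e)] and [x] in [eBe], skewness of [x * c] reads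
   [x * c = c * tau x]; hence [eBe] is commutative, and [B] being simple, [eBe] is
   the image of its center. *)
Lemma corner_scalar b : exists k, e * b * e = iota k * e.
Proof.
have comm_c x c : e * c = c -> c * tau e = c ->
    e * x * e * c = c * tau (e * x * e).
  move=> ec cte.
  have eec : e * (e * x * e * c) = e * x * e * c by rewrite !mulrA ee.
  have ctee : e * x * e * c * tau e = e * x * e * c by rewrite -mulrA cte.
  have := corner_skew eec ctee; rewrite tauM (corner_skew ec cte) mulNr.
  move/eqP; rewrite eqr_opp => /eqP /(congr1 ( *%R eps)).
  by rewrite !mulrA eps_eps !mul1r.
have comm_e x y : (e * x * e) * (e * y * e) = (e * y * e) * (e * x * e).
  apply/eqP; rewrite -subr_eq0; apply/eqP; set w := (_ - _).
  have we : w = w * e.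
    by rewrite mulrBl; congr (_ - _);
      rewrite -[RHS]mulrA -[e * _ * e * e]mulrA ee.
  rewrite we; have [||] // := @simple_prime (w * e) (tau e); last first.
    by move/tau_e_neq0.
  move=> z; set c := e * z * tau e.
  have ec : e * c = c by rewrite /c !mulrA ee.
  have cte : c * tau e = c by rewrite -mulrA tau_e_idem.
  rewrite -[w * e * z]mulrA -mulrA -/c mulrBl.
  set X := e * x * e; set Y := e * y * e.
  have eY : e * (Y * c) = Y * c by rewrite /Y !mulrA ee.
  have Yct : Y * c * tau e = Y * c by rewrite -mulrA cte.
  rewrite -[X * Y * c]mulrA (comm_c x _ eY Yct) -/X -[Y * X * c]mulrA.
  by rewrite (comm_c x _ ec cte) -/X mulrA subrr.
have [m [p [q one]]] := simple_of_central central e_neq0.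
set s := e * b * e.
have es : e * s = s by rewrite /s !mulrA ee.
have se : s * e = s by rewrite -mulrA ee.
(* Along [1 = \sum_i p i * e * q i], the element [s] of [eBe] is spread over [B]. Commutativity of
   [eBe] makes [z] central and gives [e * z * e = s]. *)
pose z := \sum_i p i * s * q i.
have cz : in_center z.
  move=> x.
  have -> : x * z = \sum_i \sum_j p j * (e * (q j * x * p i) * e) * s * q i.
    rewrite -[x * z]mul1r one /z !mulr_sumr.
    apply: eq_bigr => i _; rewrite mulr_suml; apply: eq_bigr => j _.
    by rewrite -[in LHS]es !mulrA.
  have -> : z * x = \sum_j \sum_i p j * s * (e * (q j * x * p i) * e) * q i.
    rewrite -[z * x]mulr1 one /z !mulr_suml; apply: eq_bigr => i _.
    rewrite mulr_sumr; apply: eq_bigr => j _.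
    by rewrite -[in LHS]se !mulrA.
  rewrite [LHS]exchange_big; apply: eq_bigr => i _; apply: eq_bigr => j _.
  by congr (_ * _); rewrite -[LHS]mulrA -[RHS]mulrA comm_e.
have [k kE] := (central.2 z).1 cz; exists k; rewrite -kE.
have eze : e * z * e = s.
  rewrite mulr_sumr mulr_suml.
  transitivity (\sum_i s * (e * (p i * e * q i) * e)).
    apply: eq_bigr => i _; have -> : e * (p i * s * q i) = s * (e * p i * e) * q i.
      by rewrite -[s * _]comm_e -/s -[e * p i * e * s]mulrA es !mulrA.
    by rewrite !mulrA.
  rewrite -mulr_sumr -mulr_suml -mulr_sumr -one mulr1 ee se //.
by rewrite -eze -cz -mulrA ee.
Qed.

Definition corner_coef b : K := projT1 (cid (corner_scalar b)).

Lemma corner_coefP b : e * b * e = iota (corner_coef b) * e.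
Proof. by rewrite /corner_coef; case: cid. Qed.

Lemma corner_coef_uniq b k : e * b * e = iota k * e -> corner_coef b = k.
Proof.
rewrite corner_coefP => /eqP; rewrite -subr_eq0 -mulrBl -rmorphB => /eqP ke.
apply/eqP; rewrite -subr_eq0; apply: contra_notT e_neq0 => kn0.
by rewrite -[e]mul1r -(rmorph1 iota) -(mulVf kn0) rmorphM -mulrA ke mulr0.
Qed.

Lemma corner_coefD x y : corner_coef (x + y) = corner_coef x + corner_coef y.
Proof.
by apply: corner_coef_uniq; rewrite mulrDr mulrDl !corner_coefP rmorphD mulrDl.
Qed.

Lemma corner_coefZ k x : corner_coef (iota k * x) = k * corner_coef x.
Proof.
apply: corner_coef_uniq.
have -> : e * (iota k * x) * e = iota k * (e * x * e) by rewrite mulrA -iotaC !mulrA.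
by rewrite corner_coefP rmorphM mulrA.
Qed.

Lemma corner_coef0 : corner_coef 0 = 0.
Proof. by apply: corner_coef_uniq; rewrite mulr0 mul0r rmorph0 mul0r. Qed.

Lemma corner_coef_sum m (F : 'I_m -> B) :
  corner_coef (\sum_i F i) = \sum_i corner_coef (F i).
Proof. exact: (big_morph _ corner_coefD corner_coef0). Qed.

Lemma corner_coef_e : corner_coef e = 1.
Proof. by apply: corner_coef_uniq; rewrite !ee rmorph1 mul1r. Qed.

Lemma corner_coefM x y :
  corner_coef (x * e * y) = corner_coef x * corner_coef y.
Proof.
apply: corner_coef_uniq.
have -> : e * (x * e * y) * e = e * x * e * (e * y * e).
  by rewrite !mulrA -[e * x * e * e]mulrA ee.
by rewrite !corner_coefP rmorphM !mulrA -[iota _ * e * _]mulrA -iotaC -!mulrA ee.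
Qed.

(* The elements [p i] of a shortest decomposition of [1] are independent. *)
Lemma corner_matrix_units : exists n, exists p q : 'I_n -> B,
  [/\ forall i, p i * e = p i, forall i, e * q i = q i, \sum_i p i * q i = 1 &
      forall i j, q i * p j = iota (i == j)%:R * e].
Proof.
pose P n := `[< exists p q : 'I_n -> B, 1 = \sum_i p i * e * q i >].
have exP : exists n, P n.
  have [n [p [q one]]] := simple_of_central central e_neq0.
  by exists n; apply/asboolP; exists p, q.
case: (ex_minnP exP) => n /asboolP[p [q one]] nmin.
exists n, (fun i => p i * e), (fun i => e * q i); split=> [i|i||i j].
- by rewrite -mulrA ee.
- by rewrite mulrA ee.
- by rewrite one; apply: eq_bigr => i _; rewrite mulrA -(mulrA (p i)) ee.
case: n p q one nmin i j => [|n] p q one nmin i j; first by case: i.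
have qpE : e * q i * (p j * e) = iota (corner_coef (q i * p j)) * e.
  by rewrite -corner_coefP !mulrA.
rewrite qpE; congr (iota _ * _).
(* Expanding [p j * e] by the decomposition of 1 gives the relation with coefficients [d k] among
   the [p k * e]. A nonzero [d i] would eliminate [p i] and shorten the decomposition. *)
pose d i := corner_coef (q i * p j) - (i == j)%:R.
suff d0 : d i = 0 by apply/eqP; rewrite -subr_eq0 -/(d i) d0.
apply/eqP; apply: contraT => dn0.
have rel : \sum_k iota (d k) * (p k * e) = 0.
  under eq_bigr do rewrite rmorphB mulrBl; rewrite sumrB.
  have -> : \sum_k iota (k == j)%:R * (p k * e) = p j * e.
    rewrite (bigD1 j) //= eqxx rmorph1 mul1r big1 ?addr0 // => k /negPf ->.
    by rewrite rmorph0 mul0r.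
  apply/eqP; rewrite subr_eq0; apply/eqP.
  rewrite -[RHS]mul1r one mulr_suml; apply: eq_bigr => k _.
  have -> : p k * e * q k * (p j * e) = p k * (e * (q k * p j) * e) by rewrite !mulrA.
  by rewrite corner_coefP !mulrA iotaC.
have /nmin : P n; last by rewrite ltnn.
apply/asboolP; exists (fun k => p (lift i k)),
  (fun k => q (lift i k) - iota (d (lift i k) / d i) * q i).
have piE : p i * e = - \sum_k iota (d (lift i k) / d i) * (p (lift i k) * e).
  move: rel; rewrite (bigD1_ord i) //= => /eqP; rewrite addr_eq0 => /eqP rel.
  rewrite -[LHS]mul1r -(rmorph1 iota) -(mulVf dn0) rmorphM -mulrA rel mulrN.
  rewrite mulr_sumr; congr (- _); apply: eq_bigr => k _.
  by rewrite mulrA -rmorphM mulrC.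
rewrite one (bigD1_ord i) //= piE mulNr mulr_suml addrC -sumrB.
apply: eq_bigr => k _; rewrite mulrBr; congr (_ - _).
by rewrite [RHS]mulrA -iotaC.
Qed.

(** * The splitting given by the left ideal [Be] *)

Section MatrixUnits.
Variables (n : nat) (p q : 'I_n -> B).
Hypothesis p_e : forall i, p i * e = p i.
Hypothesis e_q : forall i, e * q i = q i.
Hypothesis pq1 : \sum_i p i * q i = 1.
Hypothesis qp : forall i j, q i * p j = iota (i == j)%:R * e.

Local Notation coef := corner_coef.

Lemma coef_eq b : e * b = b -> b * e = b -> b = iota (coef b) * e.
Proof. by move=> eb be; rewrite -corner_coefP eb be. Qed.

(** The matrix of left multiplication by [b] on [Be], in the basis [p j] with coordinate functions
    [x ↦ coef (q i * x)]. *)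
Definition split_fun (b : B) : 'M[K]_n := \matrix_(i, j) coef (q i * b * p j).

Lemma split_funE i b j : q i * b * p j = iota (split_fun b i j) * e.
Proof.
by rewrite mxE; apply: coef_eq; rewrite ?mulrA ?e_q // -mulrA p_e.
Qed.

Lemma split_fun_zmod : zmod_morphism split_fun.
Proof.
move=> x y; apply/matrixP => i j; rewrite !mxE mulrBr mulrBl corner_coefD.
by rewrite -[- (_ * y * _)]mul1r -[1](rmorph1 iota) mulrN -mulNr -rmorphN
  corner_coefZ mulN1r.
Qed.

Lemma split_fun_monoid : monoid_morphism split_fun.
Proof.
split=> [|x y]; apply/matrixP => i j; rewrite !mxE.
  by rewrite mulr1 qp corner_coefZ corner_coef_e mulr1.
have -> : q i * (x * y) * p j = \sum_k (q i * x * p k) * e * (q k * y * p j).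
  rewrite -{1}[x]mulr1 -pq1 mulr_sumr mulr_suml mulr_sumr mulr_suml.
  by apply: eq_bigr => k _; rewrite -[_ * p k * e]mulrA p_e !mulrA.
rewrite corner_coef_sum; apply: eq_bigr => k _.
by rewrite corner_coefM !mxE.
Qed.

Definition split_mor : {rmorphism B -> 'M[K]_n} :=
  HB.pack split_fun (GRing.isZmodMorphism.Build _ _ _ split_fun_zmod)
    (GRing.isMonoidMorphism.Build _ _ _ split_fun_monoid).

Lemma split_fun_iota c : split_fun (iota c) = c%:M.
Proof.
apply/matrixP => i j; rewrite !mxE -iotaC -mulrA qp corner_coefZ corner_coefZ.
by rewrite corner_coef_e mulr1 mulr_natr.
Qed.

Lemma split_fun_expand b : b = \sum_i \sum_j iota (split_fun b i j) * (p i * q j).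
Proof.
transitivity ((\sum_i p i * q i) * b * (\sum_i p i * q i)).
  by rewrite pq1 mul1r mulr1.
rewrite !mulr_suml; apply: eq_bigr => i _; rewrite mulr_sumr; apply: eq_bigr => j _.
have -> : p i * q i * b * (p j * q j) = p i * (q i * b * p j) * q j by rewrite !mulrA.
by rewrite split_funE iotaC [p i * (e * _)]mulrA p_e -iotaC -mulrA.
Qed.

Lemma split_fun_units i j : split_fun (p i * q j) = delta_mx i j.
Proof.
apply/matrixP => k l; rewrite !mxE.
have -> : q k * (p i * q j) * p l = q k * p i * (q j * p l) by rewrite !mulrA.
rewrite !qp -mulrA [e * _]mulrA -iotaC -mulrA ee !corner_coefZ corner_coef_e.
by rewrite mulr1 -natrM mulnb (eq_sym j).
Qed.

Definition unit_basis (k : 'I_(n * n)) : B := mxvec (\matrix_(i, j) (p i * q j)) 0 k.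

Lemma sum_mxvec (V : nmodType) (F : 'I_(n * n) -> V) :
  \sum_k F k = \sum_i \sum_j F (mxvec_index i j).
Proof.
rewrite pair_bigA /= (reindex _ (curry_mxvec_bij n n)).
by apply: eq_bigr => -[i j] _.
Qed.

Lemma split_fun_comb (d : 'M[K]_n) :
  split_fun (\sum_i \sum_j iota (d i j) * (p i * q j)) = d.
Proof.
rewrite [RHS]matrix_sum_delta -[LHS]/(split_mor _) raddf_sum; apply: eq_bigr => i _.
rewrite raddf_sum; apply: eq_bigr => j _.
rewrite [LHS](rmorphM split_mor) /= split_fun_iota split_fun_units.
exact: mul_scalar_mx.
Qed.

Lemma unit_basisP : algebra_basis iota unit_basis.
Proof.
move=> b; exists [ffun k => mxvec (split_fun b) 0 k]; split.
  rewrite sum_mxvec {1}[b]split_fun_expand; apply: eq_bigr => i _.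
  by apply: eq_bigr => j _; rewrite ffunE /unit_basis !mxvecE [in RHS]mxE.
move=> c bE; suff -> : split_fun b = vec_mx (\row_k c k).
  by apply/ffunP => k; rewrite ffunE vec_mxK mxE.
rewrite -[RHS]split_fun_comb bE sum_mxvec; congr split_fun.
apply: eq_bigr => i _; apply: eq_bigr => j _.
by rewrite /unit_basis mxvecE !mxE.
Qed.

Lemma split_basisP :
  algebra_basis (@scalar_mx K n : {rmorphism K -> 'M[K]_n}) (split_mor \o unit_basis).
Proof.
have sumE (c : 'I_(n * n) -> K) :
    \sum_k (c k)%:M * (split_mor \o unit_basis) k = vec_mx (\row_k c k).
  rewrite [RHS]matrix_sum_delta sum_mxvec; apply: eq_bigr => i _.
  apply: eq_bigr => j _; rewrite /= /unit_basis mxvecE !mxE split_fun_units.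
  exact: mul_scalar_mx.
move=> M; exists [ffun k => mxvec M 0 k]; split.
  rewrite [RHS]sumE; apply: (can_inj mxvecK); rewrite vec_mxK.
  by apply/rowP => k; rewrite !mxE ffunE.
move=> c ->; rewrite [X in mxvec X]sumE.
by apply/ffunP => k; rewrite ffunE vec_mxK mxE.
Qed.

Lemma split_degree d : algebra_degree iota d -> d = n.
Proof.
move=> [b bB]; have := algebra_basis_leq bB unit_basisP.
have := algebra_basis_leq unit_basisP bB.
by rewrite !mulnn !leq_exp2r // => le1 le2; apply/eqP; rewrite eqn_leq le1 le2.
Qed.

(** * The bilinear form on [Be] to which the involution is adjoint *)

Section Gram.
Variables (c : B) (eta : K).
Hypothesis ec : e * c = c.
Hypothesis cte : c * tau e = c.
Hypothesis c_neq0 : c <> 0.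
Hypothesis epsE : eps = iota eta.

(** The form is [(v, w) ↦ coef (c * tau v * w)] on [Be]; the factor [c] brings [tau v * w], which
    lies in [tau(e)Be], back to [eBe = Ke]. The Gram matrix here is that of the form with [w]
    replaced by [x * w]. *)
Definition gram (x : B) : 'M[K]_n := \matrix_(i, j) coef (c * tau (p i) * x * p j).

Lemma eta_eta : eta * eta = 1.
Proof. by apply: iota_inj; rewrite rmorphM rmorph1 -epsE eps_eps. Qed.

Lemma gramE x i j : c * tau (p i) * x * p j = iota (gram x i j) * e.
Proof. by rewrite mxE; apply: coef_eq; rewrite ?mulrA ?ec // -mulrA p_e. Qed.

Lemma gramM x y : gram (x * y) = gram x *m split_fun y.
Proof.
apply/matrixP => i j; rewrite !mxE.
have -> : c * tau (p i) * (x * y) * p j =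
    \sum_k (c * tau (p i) * x * p k) * e * (q k * y * p j).
  rewrite -{1}[x]mulr1 -pq1 mulr_sumr mulr_suml mulr_sumr mulr_suml.
  by apply: eq_bigr => k _; rewrite -[_ * p k * e]mulrA p_e !mulrA.
rewrite corner_coef_sum; apply: eq_bigr => k _.
by rewrite corner_coefM !mxE.
Qed.

Lemma iota_c_eq0 k : iota k * c = 0 -> k = 0.
Proof.
move=> kc; apply/eqP; apply: contra_notT c_neq0 => kn0.
by rewrite -[c]mul1r -(rmorph1 iota) -(mulVf kn0) rmorphM -mulrA kc mulr0.
Qed.

(** Right multiplication by [c] moves an entry from [Ke] to the corner [e B tau(e)], where [tau] is
    multiplication by [- eps]. Applying [tau] there exchanges the two arguments of the form. *)
Lemma gram_tau x : (gram (tau x))^T = - eta *: gram x.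
Proof.
apply/matrixP => i j; rewrite [LHS]mxE [RHS]mxE.
have tc := corner_skew ec cte.
have h1 : c * tau (p j) * tau x * p i * c = iota (gram (tau x) j i) * c.
  by rewrite gramE -mulrA ec.
have h2 : tau c * tau (p j) * tau x * p i * tau c = iota (gram x i j) * tau c.
  have : c * tau (p i) * x * p j * c = iota (gram x i j) * c.
    by rewrite gramE -mulrA ec.
  by move/(congr1 tau); rewrite !tauM tauK tau_iota -iotaC !mulrA.
move: h2; rewrite tc !mulNr !mulrN opprK -!mulrA => h2.
have h3 : c * tau (p j) * tau x * p i * c = - (iota (gram x i j) * (eps * c)).
  rewrite -h2; rewrite !mulrA -!(epsC (_ * p i)) !mulrA eps_eps mul1r //.
apply/eqP; rewrite -subr_eq0; apply/eqP/iota_c_eq0.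
rewrite rmorphB mulrBl -h1 h3 epsE mulrA -rmorphM mulrC.
by rewrite rmorphN mulNr subrr.
Qed.

(** If [x] is orthogonal to every [p i], then [c * tau y * x = 0] for all [y] in [Be]. Since
    [c * tau e = c], this says [cBx = 0], and [B] is prime. *)
Lemma gram_ker x : x * e = x -> (forall i, coef (c * tau (p i) * x) = 0) -> x = 0.
Proof.
move=> xe x0.
have cx0 i : c * tau (p i) * x = 0.
  rewrite [LHS]coef_eq ?x0 ?rmorph0 ?mul0r //; last by rewrite -mulrA xe.
  by rewrite !mulrA ec.
have [|//|//] := @simple_prime c x.
move=> b; pose y := tau b * e.
have yE : y = \sum_i iota (coef (q i * y)) * p i.
  rewrite -{1}[y]mul1r -pq1 mulr_suml; apply: eq_bigr => i _.
  have qy : q i * y = iota (coef (q i * y)) * e.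
    by apply: coef_eq; rewrite ?mulrA ?e_q // -[_ * e * e]mulrA ee.
  by rewrite -mulrA {1}qy iotaC mulrA p_e -iotaC.
have -> : c * b * x = c * tau y * x by rewrite tauM tauK mulrA cte.
rewrite yE (big_morph tau tauD tau0) mulr_sumr mulr_suml big1 // => i _.
by rewrite tauM tau_iota mulrA -iotaC -mulrA cx0 mulr0.
Qed.

Lemma coord_eq0 (v : 'cV[K]_n) : \sum_j iota (v j 0) * p j = 0 -> v = 0.
Proof.
move=> v0; apply/matrixP => i k; rewrite ord1 [RHS]mxE.
have := congr1 (fun z => coef (q i * z)) v0; rewrite /= mulr0 corner_coef0.
move=> <-; rewrite mulr_sumr corner_coef_sum (bigD1 i) //= big1 ?addr0.
  rewrite mulrA -iotaC -mulrA qp eqxx rmorph1 mul1r corner_coefZ.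
  by rewrite corner_coef_e mulr1.
move=> j /negPf ji; rewrite mulrA -iotaC -mulrA qp eq_sym ji rmorph0 mul0r.
by rewrite mulr0 corner_coef0.
Qed.

Lemma gram_mul x (v : 'cV[K]_n) i :
  (gram x *m v) i 0 = coef (c * tau (p i) * (x * \sum_j iota (v j 0) * p j)).
Proof.
rewrite mxE 2!mulr_sumr corner_coef_sum; apply: eq_bigr => j _.
rewrite mxE mulrC -corner_coefZ; congr coef.
by rewrite [iota _ * p j]iotaC [LHS]iotaC !mulrA.
Qed.

Lemma gram_unit : gram 1 \in unitmx.
Proof.
apply: unitmx_ker => v gv; apply: coord_eq0; apply: gram_ker.
  by rewrite mulr_suml; apply: eq_bigr => j _; rewrite -mulrA p_e.
by move=> i; rewrite -[X in _ * X]mul1r -gram_mul gv mxE.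
Qed.

Lemma gram_adjoint b : (split_fun (tau b))^T *m gram 1 = gram 1 *m split_fun b.
Proof.
rewrite -gramM mul1r; have := gram_tau 1; rewrite tau1 => /(canRL (@trmxK _ _ _)).
rewrite linearZ /= => g1; rewrite g1 -scalemxAr -trmx_mul -gramM mul1r.
by rewrite gram_tau scalerA mulrNN eta_eta scale1r.
Qed.

Lemma eps_tau_a : tau a = iota eta * a.
Proof. by rewrite -epsE {2}a_herm mulrA eps_eps mul1r. Qed.

(** The factor [eta] from [gram_tau] cancels the one in [tau a = iota eta * a], so the matrix is
    skew for either sign of [eps]. *)
Lemma gram_a_skew : (gram a)^T = - gram a.
Proof.
have := gram_tau (tau a); rewrite tauK => ->.
apply/matrixP => i j; rewrite !mxE eps_tau_a [_ * (iota _ * a)]mulrA -iotaC.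
by rewrite -!mulrA corner_coefZ mulNr [eta * (eta * _)]mulrA eta_eta mul1r.
Qed.

Lemma corner_neq0_swap : exists b, c * b * e <> 0 /\ c * b * c <> 0.
Proof.
apply: contrapT => /forallNP H.
have [|//|//] := @simple_prime c c; move=> b; apply: contrapT => cbc; apply: (H b).
split=> // cbe; apply: cbc.
by rewrite -[RHS](mul0r c) -cbe -[RHS]mulrA ec.
Qed.

(* The kernel of [gram a] is the line [tau(e)Be]. *)
Lemma degree_odd : odd n.
Proof.
have [b [cbe cbc]] := corner_neq0_swap.
pose c0 := tau e * b * e.
have cc0 : c * c0 = c * b * e by rewrite !mulrA cte.
have tec0 : tau e * c0 = c0 by rewrite !mulrA tau_e_idem.
have c0e : c0 * e = c0 by rewrite -mulrA ee.
have corner_tau x : tau e * x * tau e = iota (coef (tau x)) * tau e.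
  by rewrite -[x in LHS]tauK -!tauM mulrA corner_coefP tauM tau_iota -iotaC.
pose v0 : 'cV[K]_n := \col_j coef (q j * c0).
have expand x : x * e = x -> x = \sum_j iota (coef (q j * x)) * p j.
  move=> xe; rewrite -{1}[x]mul1r -pq1 mulr_suml; apply: eq_bigr => j _.
  have qx : q j * x = iota (coef (q j * x)) * e.
    by apply: coef_eq; rewrite ?mulrA ?e_q // -mulrA xe.
  by rewrite -mulrA {1}qx iotaC mulrA p_e -iotaC.
have v0E : \sum_j iota (v0 j 0) * p j = c0.
  by rewrite [RHS]expand //; apply: eq_bigr => j _; rewrite mxE.
apply: (@skew_corank1_odd _ _ (gram a) v0 two_neq0 gram_a_skew).
- apply: contra_notN cbe => /eqP v00; rewrite -cc0 -v0E v00 big1 ?mulr0 // => j _.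
  by rewrite mxE rmorph0 mul0r.
- apply/matrixP => i j; rewrite ord1 gram_mul v0E -tec0 [a * _]mulrA.
  have -> : a * tau e = 0.
    by rewrite a_herm -mulrA -tauM ea tau0 mulr0.
  by rewrite mul0r mulr0 corner_coef0 mxE.
move=> v gv; set x := \sum_j iota (v j 0) * p j.
have xe : x * e = x by rewrite mulr_suml; apply: eq_bigr => j _; rewrite -mulrA p_e.
have ax : a * x = 0.
  apply: gram_ker => [|i]; first by rewrite -mulrA xe.
  by rewrite -gram_mul gv mxE.
have tex := ker_a ax.
have cc0E : c * c0 = iota (coef (c * c0)) * e.
  by apply: coef_eq; rewrite ?mulrA ?ec // -!mulrA ee.
have cxE : c * x = iota (coef (c * x)) * e.
  by apply: coef_eq; rewrite ?mulrA ?ec // -!mulrA xe.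
set k := coef (c * c0) in cc0E; set m := coef (c * x) in cxE.
have kn0 : k != 0.
  by apply: contra_notN cbe => /eqP k0; rewrite -cc0 cc0E k0 rmorph0 mul0r.
exists (m / k).
(* The scalar is the ratio of [c * x] to [c * c0] in [Ke]. The difference [w] lies in [tau(e)B] and
   is killed by [c], hence by [c0 * c], a nonzero multiple of [tau e]. *)
suff xE : x = iota (m / k) * c0.
  apply/eqP; rewrite -subr_eq0; apply/eqP/coord_eq0.
  rewrite -[RHS](subrr x) {2}xE -v0E mulr_sumr -sumrB; apply: eq_bigr => j _.
  have -> : (v - (m / k) *: v0) j 0 = v j 0 - m / k * v0 j 0 by rewrite !mxE.
  by rewrite rmorphB mulrBl [iota (m / k * _)]rmorphM mulrA.
apply/eqP; rewrite -subr_eq0; apply/eqP; set w := (_ - _).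
have cw : c * w = 0.
  rewrite mulrBr mulrA -iotaC -mulrA cc0E cxE mulrA -rmorphM divfK // subrr //.
have tew : tau e * w = w by rewrite mulrBr -tex mulrA -iotaC -mulrA tec0.
have c0c : c0 * c = iota (coef (tau (b * e * c))) * tau e.
  by rewrite -corner_tau -[LHS]mulr1 /c0 -{1}cte !mulrA mulr1.
have ln0 : coef (tau (b * e * c)) != 0.
  apply: contra_notN cbc => /eqP l0.
  have : c * (c0 * c) = 0 by rewrite c0c l0 rmorph0 mul0r mulr0.
  by rewrite mulrA cc0 -mulrA ec.
have : c0 * c * w = 0 by rewrite -mulrA cw mulr0.
rewrite c0c -mulrA tew => lw.
have := mulr0 (iota (coef (tau (b * e * c)))^-1).
by rewrite -{1}lw mulrA -rmorphM mulVf // rmorph1 mul1r.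
Qed.

Lemma gram_symplectic : eps = 1 -> symplectic_involution iota tau.
Proof.
move=> eps1; exists K, idfun, n, split_mor, (gram 1).
have eta1 : eta = 1 by apply: iota_inj; rewrite -epsE eps1 rmorph1.
split; last exact: gram_adjoint.
- split; first exact: split_fun_iota.
  by exists (n * n)%N, unit_basis; split; [exact: unit_basisP | exact: split_basisP].
- exact: gram_unit.
- apply: skew_alternating => //.
  by have := gram_tau 1; rewrite tau1 eta1 scaleN1r.
Qed.

(* For any splitting [rho] with alternating Gram matrix [h], the matrix
   [N1 = h *m rho c] is skew and [N1 *m M *m N1] is proportional to [N1] for all
   [M]; for [M = v *m v^T] this gives [N1 *m v = 0]. *)
Lemma gram_orthogonal : eps = -1 -> orthogonal_involution iota tau.
Proof.
move=> eps1 [L [psi [m [rho [h [[rho_iota [d [b [bB rbB]]]] hU halt hadj]]]]]].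
have tc : tau c = c by rewrite (corner_skew ec cte) eps1 mulN1r opprK.
have psi2 : 2%:R != 0 :> L by rewrite -(rmorph_nat psi) fmorph_eq0.
have hT : h^T = - h.
  apply/matrixP => i j; rewrite !mxE; apply/eqP; rewrite -addr_eq0; apply/eqP.
  have entry k l : ((delta_mx k 0 : 'cV[L]_m)^T *m h *m
      (delta_mx l 0 : 'cV_m)) 0 0 = h k l.
    by rewrite trmx_delta -rowE -colE !mxE.
  have := halt (delta_mx i 0 + delta_mx j 0).
  rewrite [(_ + _)^T]linearD !mulmxDl !mulmxDr.
  by rewrite !halt add0r addr0 => /matrixP/(_ 0 0); rewrite mxE !entry mxE addrC.
pose N1 := h *m rho c.
have N1T : N1^T = - N1.
  by rewrite trmx_mul hT mulmxN /N1 -hadj tc.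
have cbc x : exists l, c * x * c = iota l * c.
  have [l lE] := corner_scalar (c * x); exists l.
  have -> : c * x * c = e * (c * x) * e * c by rewrite !mulrA ec -[RHS]mulrA ec.
  by rewrite lE -mulrA ec.
have CMC (M : 'M[L]_m) : exists l, rho c *m M *m rho c = l *: rho c.
  have [k [-> _]] := rbB M.
  pose l j := projT1 (cid (cbc (b j))).
  have lE j : c * b j * c = iota (l j) * c by rewrite /l; case: cid.
  exists (\sum_j k j * psi (l j)); rewrite mulmx_sumr mulmx_suml scaler_suml.
  apply: eq_bigr => j _.
  have -> : (k j)%:M * (rho \o b) j = k j *: rho (b j) by exact: mul_scalar_mx.
  rewrite -scalemxAr -scalemxAl -scalerA; congr (_ *: _).
  have := congr1 rho (lE j); rewrite !rmorphM rho_iota => rE.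
  by rewrite -mul_scalar_mx; exact: rE.
have N1_0 : N1 = 0.
  have N1v (v : 'cV[L]_m) : N1 *m v = 0.
    have [l lE] := CMC (v *m v^T *m h).
    (* The left side is symmetric and the right side skew, so both vanish; the diagonal of the left
       side holds the squares of the entries of [N1 *m v]. *)
    have NvvN : N1 *m v *m (N1 *m v)^T = - (l *: N1).
      by rewrite trmx_mul N1T !mulmxN /N1 scalemxAr -lE !mulmxA.
    have : (N1 *m v *m (N1 *m v)^T)^T = N1 *m v *m (N1 *m v)^T.
      by rewrite trmx_mul trmxK.
    rewrite NvvN linearN linearZ /= N1T scalerN => /eqP.
    rewrite eq_sym -addr_eq0 -opprD oppr_eq0 -mulr2n -scaler_nat scaler_eq0.
    rewrite (negPf psi2) => /eqP lN.
    apply/matrixP => i j; rewrite ord1 [RHS]mxE.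
    move: NvvN; rewrite lN oppr0 => /matrixP/(_ i i); rewrite !mxE big_ord1.
    by rewrite !mxE => /eqP; rewrite mulf_eq0 orbb => /eqP.
  apply/matrixP => i j; have /matrixP/(_ i 0) := N1v (delta_mx j 0).
  by rewrite -colE !mxE.
have rc0 : rho c = 0 by rewrite -(mulKmx hU (rho c)) -/N1 N1_0 mulmx0.
(* [rho] carries a basis to a basis, so the coordinates of [c] vanish along with those of
   [rho c]. *)
have [k [cE _]] := bB c.
have [k' [_ ku]] := rbB 0.
apply: c_neq0; rewrite cE big1 // => j _.
suff -> : k j = 0 by rewrite rmorph0 mul0r.
have z1 : 0 = \sum_j ([ffun j => psi (k j)] j)%:M * (rho \o b) j.
  transitivity (rho c); first by rewrite rc0.
  rewrite cE rmorph_sum; apply: eq_bigr => i _.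
  by rewrite rmorphM rho_iota ffunE.
have z2 : 0 = \sum_j ([ffun=> 0] j : L)%:M * (rho \o b) j.
  by rewrite big1 // => i _; rewrite ffunE raddf0 mul0r.
have /ffunP/(_ j) : [ffun j => psi (k j)] = [ffun=> 0].
  by rewrite -(ku _ z1) -(ku _ z2).
by rewrite !ffunE => /eqP; rewrite fmorph_eq0 => /eqP.
Qed.

End Gram.
End MatrixUnits.

Lemma skew_corner_fiber :
  [/\ algebra_central iota,
      symplectic_involution iota tau /\ eps = 1 \/
        orthogonal_involution iota tau /\ eps = -1
    & forall d, algebra_degree iota d -> odd d].
Proof.
have [n [p [q [p_e e_q pq1 qp]]]] := corner_matrix_units.
have [b cn0] := corner_neq0; set c := e * b * tau e in cn0.
have ec : e * c = c by rewrite !mulrA ee.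
have cte : c * tau e = c by rewrite -mulrA tau_e_idem.
have [eta epsE] := (central.2 eps).1 epsC.
split; first exact: central.
  case: eps_sign => e1; [left | right]; split=> //.
    exact: (gram_symplectic p_e e_q pq1 qp ec cte cn0 epsE).
  exact: (gram_orthogonal ec cte cn0).
move=> d /(split_degree p_e e_q pq1 qp) ->.
exact: (degree_odd p_e e_q pq1 qp ec cte cn0 epsE).
Qed.

End SkewCorner.

Theorem unit_or_symplectic (S : B -> Prop) (a0 : B) : S a0 ->
    (forall a, S a -> a = eps * tau a) ->
    (forall a, S a -> exists u d c, a * c + u = 1 /\
       forall b, S (a + u * b + eps * tau (u * b) + tau b * d * b)) ->
  (exists a, S a /\ exists a', a * a' = 1 /\ a' * a = 1) \/
  [/\ algebra_central iota,
      symplectic_involution iota tau /\ eps = 1 \/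
        orthogonal_involution iota tau /\ eps = -1
    & forall d, algebra_degree iota d -> odd d].
Proof.
move=> Sa0 Sherm Spert.
have [|[a [t [ah ata en0 sk]]]] := unit_or_skew Sa0 Sherm Spert; first by left.
right; apply: (@skew_corner_fiber a (1 - a * t)) => //.
- exact: pert_ee.
- exact: pert_ea.
- by move=> z; apply: pert_ker.
Qed.

End SeparableFiniteAlgebra.

(** * Finite generation of projective separable algebras *)

Section FiniteDualBasis.
Import freeg.
Variables (R : comNzRingType) (A : algType R).

(** The idempotent is the image of 1 under a section of [t ↦ t *: 1], linear over the enveloping
    algebra. It commutes with [b] because [b ⊗ 1] and [1 ⊗ b] act alike on 1. *)
Lemma separability_idempotent : separable_algebra A ->
  exists n (x y : 'I_n -> A), \sum_i x i * y i = 1 /\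
    forall (V : lmodType R) (F : A -> A -> V), bilinear_for *:%R *:%R F ->
    forall b, \sum_i F (b * x i) (y i) = \sum_i F (x i) (y i * b).
Proof.
move=> sepA; set Ae := tensor A A^c; set M := enveloping_module A.
pose mu (t : Ae^o) : M := (t : Ae) *: ((1 : A) : M).
have mu_lin : linear mu by move=> t u v; rewrite /mu scalerDl -scalerA.
pose muL : {linear Ae^o -> M} := HB.pack mu (GRing.isLinear.Build _ _ _ _ mu mu_lin).
have mu_surj (a : M) : exists t, muL t = a.
  by exists (tens (a : A) (1 : A^c)); rewrite /= /mu [LHS]enveloping_scale_tens !mulr1.
have [h hK] := sepA _ _ muL (idfun : {linear M -> M}) mu_surj.
pose u : Ae := h (1 : A).
have hZ (t : Ae) (z : M) : h (t *: z) = t * (h z : Ae) by rewrite linearZ.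
have uC (b : A) : tens b (1 : A^c) * u = tens (1 : A) (b : A^c) * u.
  rewrite /u -!hZ.
  congr (h _); transitivity (b : A).
    by rewrite [LHS]enveloping_scale_tens !mulr1.
  by rewrite [RHS]enveloping_scale_tens !mul1r.
pose n := size (repr u); pose xy (i : 'I_n) := tnth (in_tuple (repr u)) i.
have uE : u = \sum_i tens (xy i).1 (xy i).2 by rewrite {1}[u]tensorE big_tnth.
exists n, (fun i => (xy i).1), (fun i => (xy i).2); split.
  have := hK (1 : A); rewrite /= /mu -/u uE scaler_suml => h1; rewrite -[RHS]h1.
  by apply: eq_bigr => i _; rewrite [RHS]enveloping_scale_tens mulr1.
move=> V F FB b.
have FB' : bilinear_for *:%R *:%R (F : A -> A^c -> V) by exact: FB.
pose lF := tensor_lift (F : A -> A^c -> V).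
have lF_lin : linear lF by exact: tensor_lift_is_linear.
have lF_sum (t : 'I_n -> Ae) : lF (\sum_i t i) = \sum_i lF (t i).
  apply: (big_morph lF); first by move=> v w; have := lF_lin 1 v w; rewrite !scale1r.
  exact: tensor_lift0.
have := congr1 lF (uC b); rewrite uE !mulr_sumr !lF_sum.
under eq_bigr do rewrite tensM mul1r /lF tensor_lift_tens //.
by under [RHS]eq_bigr do rewrite tensM mul1r /lF tensor_lift_tens //.
Qed.

(** Split the map onto [A] from the free module on the underlying set of [A]. The family is indexed
    by [A] itself, with finite support at each argument. *)
Lemma projective_dual_family : projective_module A ->
  exists f : A -> A -> R,
    (forall z, scalar (f z)) /\
    forall a, exists s : seq A, [/\ uniq s, forall z, z \notin s -> f z a = 0
      & a = \sum_(z <- s) f z a *: z].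
Proof.
move=> projA; pose L := {freeg A / R}.
have g_lin : linear (fglift (idfun : A -> A) : L -> A).
  move=> c D1 D2.
  have add := lift_is_additive (idfun : A -> A).
  have add0 : fglift (idfun : A -> A) (0 : L) = 0 by have := add 0 0; rewrite !subrr.
  have addD D D' : fglift (idfun : A -> A) (D + D' : L) =
      fglift (idfun : A -> A) D + fglift (idfun : A -> A) D'.
    have addN E : fglift (idfun : A -> A) (- E : L) = - fglift (idfun : A -> A) E.
      by rewrite -sub0r add add0 sub0r.
    by rewrite -{1}[D']opprK add addN opprK.
  have addS (I : Type) (s : seq I) (F : I -> L) :
    fglift (idfun : A -> A) (\sum_(i <- s) F i) =
      \sum_(i <- s) fglift (idfun : A -> A) (F i) := big_morph _ addD add0 s xpredT F.
  rewrite addD; congr (_ + _); rewrite -{2}[D1]freeg_sumE.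
  rewrite [LHS](addS _ (dom D1)) addS scaler_sumr.
  by apply: eq_bigr => z _; rewrite !liftU scalerA.
pose g : {linear L -> A} := HB.pack (fglift (idfun : A -> A) : L -> A)
   (GRing.isLinear.Build _ _ _ _ (fglift (idfun : A -> A) : L -> A) g_lin).
have g_surj (a : A) : exists t, g t = a.
  by exists << a >>; rewrite /= liftU scale1r.
have [h hK] := projA _ _ g (idfun : {linear A -> A}) g_surj.
exists (fun z a => coeff z (h a)); split.
  by move=> z r a b; rewrite linearP coeffD coeffZ.
move=> a; exists (dom (h a)); split; first exact: uniq_dom.
  by move=> z; apply: coeff_outdom.
rewrite -{1}[a]hK -{1}[h a]freeg_sumE raddf_sum.
by apply: eq_bigr => z _; rewrite /= liftU.
Qed.

Lemma eq_big_support (I : eqType) (V : nmodType) (s t : seq I) (F : I -> V) :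
    uniq s -> uniq t -> (forall i, i \notin s -> F i = 0) ->
    (forall i, i \notin t -> F i = 0) ->
  \sum_(i <- s) F i = \sum_(i <- t) F i.
Proof.
move=> us ut Fs Ft.
rewrite (bigID (mem t)) /= [X in _ + X]big1 ?addr0 //.
rewrite [RHS](bigID (mem s)) /= [X in _ = _ + X]big1 ?addr0 //.
rewrite -[LHS]big_filter -[RHS]big_filter; apply: perm_big; apply: uniq_perm.
- exact: filter_uniq.
- exact: filter_uniq.
- by move=> i; rewrite !mem_filter andbC.
Qed.

(* Villamayor-Zelinsky: a separability idempotent cuts a possibly infinite
   dual basis of a projective algebra down to a finite one. *)
Lemma finite_dual_basis : projective_module A -> separable_algebra A ->
  exists N (crd : 'I_N -> A -> R) (gen : 'I_N -> A),
    (forall i, scalar (crd i)) /\ forall a, a = \sum_i crd i a *: gen i.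
Proof.
move=> /projective_dual_family[f [f_lin fP]].
move=> /separability_idempotent[n [x [y [xy1 xyC]]]].
have fsum a s : uniq s -> (forall z, z \notin s -> f z a = 0) ->
    a = \sum_(z <- s) f z a *: z.
  move=> us fs; have [t [ut ft {1}->]] := fP a.
  by apply: eq_big_support => // z; [move/ft | move/fs] => ->; rewrite scale0r.
pose supp a := projT1 (cid (fP a)).
have suppP a z : z \notin supp a -> f z a = 0.
  by rewrite /supp; case: cid => s [_ fs _] /=; apply: fs.
pose Z0 := undup (flatten [seq supp (x j) | j <- enum 'I_n]).
(* The separability identity moves [a] out of the argument of [f z], so the finite set [Z0] serves
   for all [a] at once. *)
have f0 z a : z \notin Z0 -> \sum_j f z (a * x j) *: y j = 0.
  move=> zZ; rewrite (xyC A (fun u v => f z u *: v)); last first.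
    split=> [v r u u'|u r v v'] /=; first by rewrite f_lin scalerDl scalerA.
    by rewrite scalerDr !scalerA mulrC.
  apply: big1 => j _; rewrite suppP ?scale0r //; apply: contra zZ => zx.
  rewrite mem_undup; apply/flattenP; exists (supp (x j)) => //.
  by apply: map_f; rewrite mem_enum.
pose T : finType := ('I_n * 'I_(size Z0))%type.
pose z (k : 'I_(size Z0)) := tnth (in_tuple Z0) k.
suff aE a : a = \sum_(t : T) f (z t.2) (a * x t.1) *: (z t.2 * y t.1).
  exists #|T|, (fun i a => f (z (enum_val i).2) (a * x (enum_val i).1)),
    (fun i => z (enum_val i).2 * y (enum_val i).1); split=> [i r a b|a].
    by rewrite mulrDl -scalerAl f_lin.
  by rewrite {1}[a]aE (reindex _ (onW_bij _ (@enum_val_bij T))).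
pose D := undup (Z0 ++ flatten [seq supp (a * x j) | j <- enum 'I_n]).
have axE j : a * x j = \sum_(z <- D) f z (a * x j) *: z.
  apply: fsum; first exact: undup_uniq.
  move=> w wD; apply: suppP; apply: contra wD => ws; rewrite mem_undup mem_cat.
  apply/orP; right; apply/flattenP; exists (supp (a * x j)) => //.
  by apply: map_f; rewrite mem_enum.
have -> : \sum_(t : T) f (z t.2) (a * x t.1) *: (z t.2 * y t.1) =
    \sum_(w <- Z0) w * \sum_j f w (a * x j) *: y j.
  rewrite -(pair_bigA _ (fun j k => f (z k) (a * x j) *: (z k * y j))) /=.
  rewrite exchange_big [RHS]big_tnth; apply: eq_bigr => k _ /=.
  by rewrite mulr_sumr; apply: eq_bigr => j _; rewrite scalerAr.
transitivity (\sum_(w <- D) w * \sum_j f w (a * x j) *: y j).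
  rewrite -[LHS]mulr1 -xy1 mulr_sumr.
  under eq_bigr do rewrite mulrA axE mulr_suml.
  rewrite exchange_big; apply: eq_bigr => w _ /=; rewrite mulr_sumr.
  by apply: eq_bigr => j _; rewrite -scalerAl scalerAr.
apply: eq_big_support; try exact: undup_uniq; move=> w.
  rewrite mem_undup mem_cat negb_or => /andP[wZ _]; by rewrite f0 ?mulr0.
by move=> wZ; rewrite f0 ?mulr0.
Qed.

End FiniteDualBasis.

(** * Maximal ideals of semilocal rings *)

Section MaximalIdeals.
Variable R : comNzRingType.

(** Proper ideals as bare predicates, convenient for unions of chains and for ideals defined by an
    existential. *)
Definition ideal_of (S : R -> Prop) : Prop :=
  [/\ S 0, ~ S 1 & forall a u v, S u -> S v -> S (a * u + v)].

Lemma ideal_of_idealr (S : R -> Prop) : ideal_of S ->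
  exists I : idealr R, forall r, r \in I <-> S r.
Proof.
move=> [S0 S1 SD]; pose T : R -> bool := fun r => `[< S r >].
have TI : idealr_closed T.
  split; first exact/asboolP.
    by apply/negP => /asboolP.
  by move=> a u v /asboolP Su /asboolP Sv; apply/asboolP/SD.
pose I : idealr R := HB.pack T (isIdealr.Build R T TI).
by exists I => r; split => [/asboolP|Sr] //; apply/asboolP.
Qed.

Lemma idealr_ideal_of (I : idealr R) : ideal_of (fun r => r \in I).
Proof.
split; first exact: idealr0; first by rewrite idealr1.
by move=> a u v Iu Iv; apply: rpredD => //; apply: idealMr.
Qed.

Lemma maximal_ideal_add (I : idealr R) x : maximal_ideal I -> x \notin I ->
  exists r, 1 - r * x \in I.
Proof.
move=> maxI xI; apply: contrapT => /forallNP noinv.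
pose S r := exists y, r - y * x \in I.
have /ideal_of_idealr[J JP] : ideal_of S.
  split; first by exists 0; rewrite mul0r subr0; exact: idealr0.
    by case=> y /noinv.
  move=> a u v [y uI] [z vI]; exists (a * y + z).
  have -> : a * u + v - (a * y + z) * x = a * (u - y * x) + (v - z * x).
    by rewrite mulrDl mulrBr opprD addrACA mulrA.
  by apply: rpredD => //; apply: idealMr.
have IJ : {subset I <= J} by move=> r rI; apply/JP; exists 0; rewrite mul0r subr0.
move/negP: xI; apply; apply: (maxI J IJ); apply/JP; exists 1.
by rewrite mul1r subrr; apply: idealr0.
Qed.

Lemma maximal_ideal_prime (I : idealr R) : maximal_ideal I ->
  exists p : prime_idealr R, p =i I.
Proof.
move=> maxI; have pI : prime_idealr_closed I.
  move=> u v uvI; apply/orP; have [uI|uI] := boolP (u \in I); [by left | right].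
  have [r rI] := maximal_ideal_add maxI uI.
  have -> : v = v * (1 - r * u) + r * (u * v).
    by rewrite mulrBr mulr1 mulrC mulrA addrC mulrAC addrC subrK.
  by apply: rpredD; apply: idealMr.
pose p : prime_idealr R := HB.pack (I : R -> bool) (Idealr.on I)
  (isPrimeIdealrClosed.Build R I pI).
by exists p.
Qed.

Lemma maximal_ideal_exists (S : R -> Prop) : ideal_of S ->
  exists2 I : idealr R, maximal_ideal I & forall r, S r -> r \in I.
Proof.
move=> SI; pose P T := ideal_of T /\ forall r, S r -> T r.
pose le (T U : {T | P T}) := `[< forall r, sval T r -> sval U r >].
have [||C totC|[T [TI ST]] Tmax] := @classical_sets.ZL_preorder {T | P T}
    (exist P S (conj SI (fun r Sr => Sr))) le.
- by move=> T; apply/asboolP.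
- by move=> T U V /asboolP TU /asboolP UV; apply/asboolP => r /TU /UV.
- have [[T0 CT0]|C0] := pselect (exists T, C T); last first.
    exists (exist P S (conj SI (fun r Sr => Sr))) => T CT.
    by case: C0; exists T.
  pose U r := exists2 T, C T & sval T r.
  have PU : P U.
    split; first split.
    + by exists T0 => //; case: (svalP T0) => -[].
    + by move=> [T _]; case: (svalP T) => -[].
    + move=> a u v [T CT Tu] [T' CT' Tv].
      have [/asboolP TT|/asboolP TT] := totC _ _ CT CT'.
        by exists T' => //; case: (svalP T') => -[_ _ D] _; apply: D => //; apply: TT.
      by exists T => //; case: (svalP T) => -[_ _ D] _; apply: D => //; apply: TT.
    + by move=> r Sr; exists T0 => //; case: (svalP T0) => _; apply.
  by exists (exist P U PU) => T CT; apply/asboolP => r Tr; exists T.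
have [I IP] := ideal_of_idealr TI; exists I => [J IJ r rJ|r /ST /IP //].
have PJ : P (fun r => r \in J).
  by split=> [|x /ST /IP /IJ //]; apply: idealr_ideal_of.
have := Tmax (exist P _ PJ); rewrite /le => /(_ _)/asboolP; rewrite /=.
by move=> H; apply/IP/H => //; apply/asboolP => x /= /IP /IJ.
Qed.

(** [r i] is a product over [j != i] of elements that are 1 modulo [m i] and 0 modulo [m j]. *)
Lemma semilocal_crt : semilocal R ->
  exists n (m : 'I_n -> prime_idealr R) (r : 'I_n -> R),
    [/\ forall i, maximal_ideal (m i),
        forall I : idealr R, maximal_ideal I -> exists i, m i =i I
      & forall i j, r i - (i == j)%:R \in m j].
Proof.
move=> [N [m mP]].
(* The given list may contain repetitions and ideals that are not maximal. Keeping first occurrences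
   of maximal ones makes distinct indices comaximal. *)
pose good (i : 'I_N) : bool := `[< maximal_ideal (m i) /\
   forall j : 'I_N, (j < i)%N -> ~ (m j =i m i) >].
pose n := #|good|; pose ix (k : 'I_n) : 'I_N := enum_val k.
have ixP k : good (ix k) by exact: (enum_valP k).
have maxm k : maximal_ideal (m (ix k)) by have /asboolP[] := ixP k.
pose p k := projT1 (cid (maximal_ideal_prime (maxm k))).
have pE k : p k =i m (ix k) by rewrite /p; case: cid.
have maxp k : maximal_ideal (p k).
  move=> I sub x xI; rewrite pE; apply: (maxm k I _ x xI) => y ym.
  by apply: sub; rewrite pE.
have sep i j : i != j -> exists s, (s \in p j) /\ (s - 1 \in p i).
  move=> ij.
  have [x xj xi] : exists2 x, x \in p j & x \notin p i.
    apply: contrapT => H.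
    have sub : {subset p j <= p i}.
      by move=> x xj; apply: contraT => xi; case: H; exists x.
    have eqm : m (ix i) =i m (ix j).
      move=> x; rewrite -!pE; apply/idP/idP; last exact: sub.
      exact: (maxp j (p i) sub).
    move: ij; rewrite -(inj_eq enum_val_inj) neq_ltn => /orP[lt_ij|lt_ji].
      have /asboolP[_ /(_ _ lt_ij)] := ixP j; exact.
    by have /asboolP[_ /(_ _ lt_ji)] := ixP i; apply=> x; rewrite eqm.
  have [r rI] := maximal_ideal_add (maxp i) xi.
  exists (r * x); split; first exact: idealMr.
  by rewrite -opprB rpredN.
pose s i j := if pselect (i != j) is left ij then projT1 (cid (sep i j ij)) else 1.
have sP i j : i != j -> (s i j \in p j) /\ (s i j - 1 \in p i).
  by move=> ij; rewrite /s; case: pselect => // ij'; case: cid.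
exists n, p, (fun i => \prod_(j | j != i) s i j); split=> //.
  move=> I maxI.
  have [i0 i0I] := mP I maxI.
  have exi : exists i, `[< exists2 j : 'I_N, nat_of_ord j = i & m j =i I >].
    by exists i0; apply/asboolP; exists i0.
  case: (ex_minnP exi) => _ /asboolP[i <- iI] imin.
  have gi : good i.
    apply/asboolP; split.
      move=> J sub x xJ; rewrite iI; apply: (maxI J _ x xJ) => y yI.
      by apply: sub; rewrite iI.
    move=> j lt_ji jE.
    have /imin : `[< exists2 k : 'I_N, nat_of_ord k = j & m k =i I >].
      by apply/asboolP; exists j => // x; rewrite jE iI.
    by rewrite leqNgt lt_ji.
  exists (enum_rank_in gi i) => x; rewrite pE /ix enum_rankK_in //; exact: iI.
move=> i j; case: eqVneq => [<-|ij].
  elim/big_rec: _ => [|k y ki yI]; first by rewrite subrr; exact: idealr0.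
  have -> : s i k * y - 1 = y * (s i k - 1) + (y - 1).
    by rewrite mulrBr mulr1 addrA subrK mulrC.
  rewrite eq_sym in ki; have [_ sI] := sP _ _ ki.
  by apply: rpredD => //; apply: idealMr.
rewrite subr0 (bigD1 j) 1?eq_sym //= mulrC; apply: idealMr.
by have [] := sP _ _ ij.
Qed.

End MaximalIdeals.

(** * Fibers at maximal ideals *)

Lemma fractionP (D : idomainType) (k : {fraction D}) :
  exists n d, d != 0 /\ k * FracField.tofrac d = FracField.tofrac n.
Proof.
exists (\n_(repr k)), (\d_(repr k)); split; first exact: denom_ratioP.
rewrite -[X in X * _ = _]reprK !piE; apply/eqmodP; rewrite /= FracField.equivfE.
rewrite /FracField.mulf !numden_Ratio ?mulf_neq0 ?oner_eq0 ?denom_ratioP //.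
by rewrite !mulr1 mulrC.
Qed.

Section Fiber.
Variables (R : comNzRingType) (A : algType R) (p : prime_idealr R).
Local Notation fiber := (tensor A (residue_field p)).
Local Notation res := (@to_residue_field R p).
Local Notation scal := (fiber_scalar A p).

Definition to_fiber (a : A) : fiber := tens a 1.

Lemma to_fiberD a b : to_fiber (a + b) = to_fiber a + to_fiber b.
Proof.
by have := (tens_bilinear A (residue_field p)).1 1 1 a b; rewrite /= !scale1r.
Qed.

Lemma to_fiberM a b : to_fiber (a * b) = to_fiber a * to_fiber b.
Proof. by rewrite /to_fiber tensM mulr1. Qed.

Lemma tens_scaler (a : A) r (k : residue_field p) : tens a (r *: k) = tens (r *: a) k.
Proof.
have [b1 b2] := tens_bilinear A (residue_field p).
have h1 := b1 k r a 0; have h2 := b2 a r k 0.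
have z1 : tens (0 : A) k = 0.
  by have := b1 k (-1) 0 0; rewrite /= scaler0 addr0 scaleN1r addNr.
have z2 : tens a (0 : residue_field p) = 0.
  by have := b2 a (-1) 0 0; rewrite /= scaler0 addr0 scaleN1r addNr.
by move: h1 h2; rewrite /= z1 z2 !addr0 => -> ->.
Qed.

Lemma to_fiber0 : to_fiber 0 = 0.
Proof. by apply: (addrI (to_fiber 0)); rewrite -to_fiberD !addr0. Qed.

Lemma to_fiber_sum n (F : 'I_n -> A) :
  to_fiber (\sum_i F i) = \sum_i to_fiber (F i).
Proof. exact: (big_morph _ to_fiberD to_fiber0). Qed.

Lemma to_fiberN a : to_fiber (- a) = - to_fiber a.
Proof. by apply/eqP; rewrite -addr_eq0 -to_fiberD addNr to_fiber0. Qed.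

Lemma to_fiber1 : to_fiber 1 = 1. Proof. by []. Qed.

Lemma scal_tens k (a : A) l : scal k * tens a l = tens a (k * l).
Proof. by rewrite /= /tens_inr tensM mul1r. Qed.

Lemma to_fiberZ r a : to_fiber (r *: a) = scal (res r) * to_fiber a.
Proof.
by rewrite scal_tens /to_fiber -tens_scaler.
Qed.

Lemma scal_comm k (t : fiber) : scal k * t = t * scal k.
Proof.
elim/tensor_ind: t => [|a l t IHt]; first by rewrite mulr0 mul0r.
by rewrite mulrDr mulrDl IHt /= /tens_inr !tensM mul1r mulr1 mulrC.
Qed.

Lemma fiberZ r (t : fiber) : r *: t = scal (res r) * t.
Proof.
elim/tensor_ind: t => [|a l t IHt]; first by rewrite mulr0 scaler0.
rewrite scalerDr mulrDr IHt scal_tens; congr (_ + _).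
have [b1 b2] := tens_bilinear A (residue_field p).
have := b2 a r l 0; rewrite /= addr0 => ->.
have -> : tens a (0 : residue_field p) = 0.
  by have := b2 a (-1) 0 0; rewrite /= scaler0 addr0 scaleN1r addNr.
by rewrite addr0.
Qed.

Lemma res_eq0 r : (res r == 0) = (r \in p).
Proof.
rewrite [LHS]tofrac_eq0 -(rmorph0 \pi_{ideal_quot p}%qT).
by rewrite -[in RHS](subr0 r) Quotient.idealrBE.
Qed.

Hypothesis maxp : maximal_ideal p.

(** A denominator is nonzero modulo [p], hence invertible modulo [p] by maximality: the residue ring
    is already its fraction field. *)
Lemma res_surj k : exists r, res r = k.
Proof.
have [x [y [yn0 kyx]]] := @fractionP (residue_ring p) k.
have [r rE] : exists r, \pi_{ideal_quot p}%qT r = x by exists (repr x); rewrite reprK.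
have [d dE] : exists d, \pi_{ideal_quot p}%qT d = y by exists (repr y); rewrite reprK.
have resd : res d != 0 by rewrite [res d == 0]tofrac_eq0 dE.
have [z zd] := maximal_ideal_add maxp (negbT (etrans (esym (res_eq0 d)) (negPf resd))).
have zd1 : res z * res d = 1.
  by apply/eqP; rewrite eq_sym -subr_eq0 -rmorphM -(rmorph1 res) -rmorphB res_eq0.
exists (r * z); have -> : res (r * z) = res r * res z by rewrite rmorphM.
have -> : res r = k * res d.
  by rewrite /to_residue_field rE dE.
by rewrite -mulrA [res d * _]mulrC zd1 mulr1.
Qed.

Lemma to_fiber_surj (t : fiber) : exists a, to_fiber a = t.
Proof.
elim/tensor_ind: t => [|a l t [b <-]]; first by exists 0; rewrite to_fiber0.
have [r <-] := res_surj l; exists (r *: a + b); rewrite to_fiberD; congr (_ + _).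
by rewrite /to_fiber -tens_scaler /=; congr tens; exact: mulr1.
Qed.

Section Functional.
Variable phi : A -> R.
Hypothesis phi_lin : scalar phi.

Lemma functional_bilinear : bilinear_for *:%R *:%R
  (fun a (k : residue_field p) => phi a *: k).
Proof.
split=> [k r a b|a r k l] /=; first by rewrite phi_lin scalerDl scalerA.
by rewrite scalerDr !scalerA mulrC.
Qed.

Definition fiber_functional : fiber -> residue_field p :=
  tensor_lift (fun a (k : residue_field p) => phi a *: k).

Lemma fiber_functionalE a : fiber_functional (to_fiber a) = res (phi a).
Proof.
rewrite /fiber_functional tensor_lift_tens; last exact: functional_bilinear.
exact: mulr1.
Qed.

Lemma fiber_functionalD t u :
  fiber_functional (t + u) = fiber_functional t + fiber_functional u.
Proof.
have := tensor_lift_is_linear functional_bilinear 1 t u.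
by rewrite !scale1r.
Qed.

Lemma fiber_functionalZ k t :
  fiber_functional (scal k * t) = k * fiber_functional t.
Proof.
have [r <-] := res_surj k; rewrite -fiberZ.
have f0 : fiber_functional 0 = 0 := tensor_lift0 functional_bilinear.
have : fiber_functional (r *: t + 0) = r *: fiber_functional t + fiber_functional 0.
  exact: tensor_lift_is_linear functional_bilinear r t 0.
by rewrite f0 !addr0.
Qed.

End Functional.
Lemma to_fiber_eq0 (phi : A -> R) a : scalar phi -> to_fiber a = 0 -> phi a \in p.
Proof.
move=> phi_lin a0; rewrite -res_eq0 -fiber_functionalE // a0.
exact/eqP/(tensor_lift0 (functional_bilinear phi_lin)).
Qed.

(** Every element of the fiber lifts to [A], so the structure required by [unit_or_symplectic] is
    read off from [A]. The degree hypothesis contradicts its second outcome. *)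
Theorem fiber_unit (sigma : {linear A -> A}) (eps : A) (S : A -> Prop) (a0 : A) :
    (exists r : R, r * 2%:R = 1) -> azumaya_with_involution sigma ->
    in_center eps -> sigma eps * eps = 1 ->
    (symplectic_at p sigma eps -> even_degree_at A p) ->
    S a0 -> (forall a, S a -> a = eps * sigma a) ->
    (forall a, S a -> exists u d c, a * c + u = 1 /\
       forall b, S (a + u * b + eps * sigma (u * b) + sigma b * d * b)) ->
  exists a, S a /\ exists b, to_fiber a * to_fiber b = 1 /\ to_fiber b * to_fiber a = 1.
Proof.
move=> [half half2] [sM sK projA sepA _ sFix] epsC epsV hdeg Sa0 Sherm Spert.
have [N [crd [gen [crd_lin crd_gen]]]] := finite_dual_basis projA sepA.
have [n [x [y [xy1 xyC]]]] := separability_idempotent sepA.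
pose tau := tensor_map_left sigma : fiber -> fiber.
have tau_bil : bilinear_for *:%R *:%R
    (fun a (k : residue_field p) => tens (sigma a) k : fiber).
  have [b1 b2] := tens_bilinear A (residue_field p).
  split=> [k r a b|a r k l] /=; first by rewrite linearP b1.
  by rewrite b2.
have tauE a : tau (to_fiber a) = to_fiber (sigma a).
  exact: (tensor_lift_tens tau_bil).
have tauD t u : tau (t + u) = tau t + tau u.
  by have := tensor_lift_is_linear tau_bil 1 t u; rewrite !scale1r.
have tauM t u : tau (t * u) = tau u * tau t.
  have [[a <-] [b <-]] := (to_fiber_surj t, to_fiber_surj u).
  by rewrite -to_fiberM !tauE sM to_fiberM.
have tauK : involutive tau.
  by move=> t; have [a <-] := to_fiber_surj t; rewrite !tauE sK.
have scalE r : scal (res r) = to_fiber r%:A.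
  by rewrite to_fiberZ to_fiber1 mulr1.
have s1 : sigma 1 = 1.
  by rewrite -[sigma 1]mulr1 -{2}[1]sK -sM mulr1 sK.
have tau_scal k : tau (scal k) = scal k.
  by have [r <-] := res_surj k; rewrite scalE tauE linearZ /= s1.
have two0 : 2%:R != 0 :> residue_field p.
  apply/eqP => two0; have := oner_neq0 (residue_field p).
  by rewrite -(rmorph1 res) -half2 rmorphM rmorph_nat two0 mulr0 eqxx.
(* Averaging any lift over the separability idempotent makes it central, and does not change a class
   that is already central. *)
have center_lift z : in_center z -> exists2 z' : A, in_center z' & to_fiber z' = z.
  move=> cz; have [z0 z0E] := to_fiber_surj z.
  exists (\sum_i x i * z0 * y i).
    move=> b; rewrite mulr_suml mulr_sumr.
    have F_bil : bilinear_for *:%R *:%R (fun u v : A => u * z0 * v).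
      split=> [v r u u'|u r v v'] /=; first by rewrite !mulrDl -!scalerAl.
      by rewrite mulrDr scalerAr.
    have := xyC _ _ F_bil b; under eq_bigr do rewrite -!mulrA.
    under [RHS]eq_bigr do rewrite mulrA.
    by move=> <-; apply: eq_bigr => i _; rewrite -!mulrA.
  rewrite to_fiber_sum -[z]mulr1 -to_fiber1 -xy1 to_fiber_sum mulr_sumr.
  by apply: eq_bigr => i _; rewrite !to_fiberM z0E -cz mulrA.
have tau_fixed z : in_center z -> tau z = z -> exists k, z = scal k.
  move=> cz tz; have [z' cz' z'E] := center_lift z cz.
  (* Symmetrizing keeps the class, since [z] is fixed by [tau], and makes the lift a scalar of
     [R]. *)
  pose w := half *: (z' + sigma z').
  have csz : in_center (sigma z') by move=> b; rewrite -[b]sK -!sM cz'.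
  have [r wE] : exists r : R, w = r%:A.
    apply/sFix; split; last by rewrite /w linearZ linearD /= sK addrC.
    by move=> b; rewrite /w -scalerAl -scalerAr mulrDl mulrDr cz' csz.
  exists (res r); rewrite scalE -wE /w to_fiberZ to_fiberD -tauE z'E tz.
  rewrite -mulr2n -mulr_natl mulrA.
  have -> : (2%:R : fiber) = scal (res 2%:R) by rewrite !rmorph_nat.
  by rewrite -rmorphM -rmorphM half2 !rmorph1 mul1r.
pose SB t := exists2 a, S a & to_fiber a = t.
have crdE t : t = \sum_i scal (fiber_functional (crd i) t) * to_fiber (gen i).
  have [a <-] := to_fiber_surj t; rewrite {1}[a]crd_gen to_fiber_sum.
  by apply: eq_bigr => i _; rewrite fiber_functionalE // to_fiberZ.
have xy1F : \sum_i to_fiber (x i) * to_fiber (y i) = 1.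
  by rewrite -to_fiber1 -xy1 to_fiber_sum; apply: eq_bigr => i _; rewrite to_fiberM.
have xyCF (F : fiber -> fiber) : (forall t u, F (t + u) = F t + F u) ->
    (forall k t, F (scal k * t) = scal k * F t) ->
    forall t, \sum_i F (t * to_fiber (x i)) * to_fiber (y i) =
              \sum_i F (to_fiber (x i)) * to_fiber (y i) * t.
  move=> FD FZ t; have [b <-] := to_fiber_surj t.
  have F_bil : bilinear_for *:%R *:%R (fun u v : A => F (to_fiber u) * to_fiber v).
    split=> [v r u u'|u r v v'] /=.
      by rewrite to_fiberD FD to_fiberZ FZ mulrDl -mulrA -fiberZ.
    by rewrite to_fiberD to_fiberZ mulrDr mulrA -scal_comm -mulrA -fiberZ.
  under eq_bigr do rewrite -to_fiberM; rewrite (xyC _ _ F_bil).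
  by apply: eq_bigr => i _; rewrite to_fiberM mulrA.
have epsCF : in_center (to_fiber eps).
  by move=> t; have [a <-] := to_fiber_surj t; rewrite -!to_fiberM epsC.
have epsVF : tau (to_fiber eps) * to_fiber eps = 1.
  by rewrite tauE -to_fiberM epsV.
have SB0 : SB (to_fiber a0) by exists a0.
have SBherm t : SB t -> t = to_fiber eps * tau t.
  by move=> [a Sa <-]; rewrite tauE -to_fiberM -Sherm.
have SBpert t : SB t -> exists u d c, t * c + u = 1 /\ forall b,
    SB (t + u * b + to_fiber eps * tau (u * b) + tau b * d * b).
  move=> [a Sa <-]; have [u [d [c [acu Su]]]] := Spert a Sa.
  exists (to_fiber u), (to_fiber d), (to_fiber c); split=> [|t'].
    by rewrite -to_fiberM -to_fiberD acu.
  have [b <-] := to_fiber_surj t'.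
  exists (a + u * b + eps * sigma (u * b) + sigma b * d * b).
    exact: Su.
  by rewrite !to_fiberD !to_fiberM -!tauE to_fiberM.
have [[_ [[a Sa <-] [t [at1 ta1]]]]|[cent sympl odd_deg]] :=
  unit_or_symplectic (@scal_comm) (fun i => @fiber_functionalD _ (crd_lin i))
   (fun i => @fiber_functionalZ _ (crd_lin i)) crdE xy1F xyCF tauD tauM tauK
   tau_scal tau_fixed epsCF epsVF two0 SB0 SBherm SBpert.
  by exists a; split=> //; have [b bE] := to_fiber_surj t; exists b; rewrite bE.
have [|d dd even_d] := hdeg; first by split.
by have := odd_deg d dd; rewrite -(negbK (odd d)) -dvdn2 even_d.
Qed.

End Fiber.

(** * Units of [A] detected in the fibers *)

Section Nakayama.
Variables (R : comNzRingType) (A : algType R).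
Hypothesis (projA : projective_module A) (sepA : separable_algebra A).

(* Determinant trick: [a * b - 1] maps into [p A], so [det (1 + M)], which is
   [1] modulo [p], maps [A] into [a A]. *)
Lemma local_denominator (p : prime_idealr R) (a b : A) :
  to_fiber p a * to_fiber p b = 1 ->
  exists2 r, r \notin p & exists c, a * c = r%:A.
Proof.
move=> ab1; have [N [crd [gen [crd_lin crd_gen]]]] := finite_dual_basis projA sepA.
pose w i := (a * b - 1) * gen i.
pose M : 'M[R]_N := \matrix_(i, j) crd j (w i).
have M0 i j : M i j \in p.
  rewrite mxE; apply: to_fiber_eq0; first exact: crd_lin.
  by rewrite to_fiberM to_fiberD to_fiberN to_fiberM ab1 to_fiber1 subrr mul0r.
have genM i : \sum_j (1%:M + M) i j *: gen j = a * (b * gen i).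
  under eq_bigr do rewrite mxE scalerDl.
  rewrite big_split /= (bigD1 i) //= big1 => [|j /negPf ji]; last first.
    by rewrite mxE eq_sym ji scale0r.
  rewrite mxE eqxx scale1r addr0.
  under eq_bigr do rewrite mxE.
  by rewrite -crd_gen /w mulrBl mul1r mulrA addrC subrK.
pose d := \det (1%:M + M).
have dgen k : exists c, a * c = d *: gen k.
  exists (\sum_i (\adj (1%:M + M)) k i *: (b * gen i)).
  rewrite mulr_sumr; under eq_bigr do rewrite -scalerAr -genM scaler_sumr.
  rewrite exchange_big /=; under eq_bigr do under eq_bigr do rewrite scalerA.
  have adjE j : \sum_i (\adj (1%:M + M)) k i * (1%:M + M) i j = d *+ (k == j).
    by have /matrixP/(_ k j) := mul_adj_mx (1%:M + M); rewrite !mxE.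
  under eq_bigr do rewrite -scaler_suml adjE.
  rewrite (bigD1 k) //= eqxx big1 ?addr0 // => j /negPf jk.
  by rewrite eq_sym jk scale0r.
exists d.
  rewrite -res_eq0 -det_map_mx map_mxD map_mx1.
  have -> : map_mx (@to_residue_field R p) M = 0.
    by apply/matrixP => i j; rewrite [LHS]mxE [RHS]mxE; apply/eqP; rewrite res_eq0.
  by rewrite addr0 det1 oner_eq0.
pose c k := projT1 (cid (dgen k)).
exists (\sum_k crd k 1 *: c k); rewrite mulr_sumr [in RHS](crd_gen 1) scaler_sumr.
apply: eq_bigr => k _; rewrite -scalerAr /c; case: cid => ck /= ->.
by rewrite !scalerA mulrC.
Qed.

(** The [r] with [r%:A] in [aA] form an ideal. If it were proper, a maximal ideal would contain it,
    against [local_denominator]. *)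
Lemma fibers_right_inverse (a : A) :
    (forall I : idealr R, maximal_ideal I ->
       exists2 p : prime_idealr R, p =i I & exists b, to_fiber p a * to_fiber p b = 1) ->
  exists b, a * b = 1.
Proof.
move=> loc; apply: contrapT => noinv.
pose S r := exists c, a * c = r%:A.
have [I maxI SI] : exists2 I : idealr R, maximal_ideal I & forall r, S r -> r \in I.
  apply: maximal_ideal_exists; split.
  - by exists 0; rewrite mulr0 scale0r.
  - by move=> [b ab]; apply: noinv; exists b; rewrite ab scale1r.
  - move=> r u v [c uE] [c' vE]; exists (r *: c + c').
    by rewrite mulrDr -scalerAr uE vE scalerA scalerDl.
have [p pI [b ab]] := loc I maxI; have [r rp rS] := local_denominator ab.
by move: rp; rewrite pI SI.
Qed.

(** A right inverse [b] of [a] agrees in each fiber with the two-sided inverse there, so [b] has a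
    right inverse too. *)
Lemma fibers_inverse (a : A) :
    (forall I : idealr R, maximal_ideal I ->
       exists2 p : prime_idealr R, p =i I &
       exists b, to_fiber p a * to_fiber p b = 1 /\ to_fiber p b * to_fiber p a = 1) ->
  exists b, a * b = 1 /\ b * a = 1.
Proof.
move=> loc; have [I maxI|b ab] := @fibers_right_inverse a.
  by have [p pI [b [ab _]]] := loc I maxI; exists p => //; exists b.
have [I maxI|c bc] := @fibers_right_inverse b.
  have [p pI [b' [ab' b'a]]] := loc I maxI; exists p => //; exists a.
  have -> : to_fiber p b = to_fiber p b'.
    by rewrite -[LHS]mul1r -b'a -mulrA -to_fiberM ab to_fiber1 mulr1.
  by [].
have ac : a = c by rewrite -[a]mulr1 -bc mulrA ab mul1r.
by exists b; split=> //; rewrite ac.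
Qed.

End Nakayama.

(** * Orthogonalization *)

Section Hermitian.
Variables (R : comNzRingType) (A : algType R) (sigma : {linear A -> A}).
Variables (eps : A) (P : lmodType A^c) (f : P -> P -> A).
Hypothesis hA : azumaya_with_involution sigma.
Hypothesis heps : in_center eps.
Hypothesis hepsV : sigma eps * eps = 1.
Hypothesis hf : unimodular_hermitian sigma eps f.

Local Notation "x ** a" := ((a : A^c) *: (x : P)) (at level 40, left associativity).

Let sigmaM := azumaya_invM hA.

Lemma sigma1 : sigma 1 = 1.
Proof.
have sK := azumaya_invK hA.
by rewrite -[sigma 1]mulr1 -{2}[1]sK -sigmaM mulr1 sK.
Qed.

Lemma herm_scalel x y a : f (x ** a) y = sigma a * f x y.
Proof.
by have := herm_sesqui hf x y a 1; rewrite scale1r mulr1.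
Qed.

Lemma herm_scaler x y a : f x (y ** a) = f x y * a.
Proof.
by have := herm_sesqui hf x y 1 a; rewrite scale1r sigma1 mul1r.
Qed.

Lemma herm0l y : f 0 y = 0.
Proof. by rewrite -(scale0r (0 : P)) (herm_scalel _ _ 0) linear0 mul0r. Qed.

Lemma herm0r x : f x 0 = 0.
Proof. by rewrite -(scale0r (0 : P)) (herm_scaler _ _ 0) mulr0. Qed.

Lemma herm_suml n (F : 'I_n -> P) y : f (\sum_i F i) y = \sum_i f (F i) y.
Proof. exact: (big_morph (f^~ y) (fun u v => herm_addl hf u v y) (herm0l y)). Qed.

Lemma herm_sumr n (F : 'I_n -> P) x : f x (\sum_i F i) = \sum_i f x (F i).
Proof. exact: (big_morph (f x) (herm_addr hf x) (herm0r x)). Qed.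

Lemma herm_orth_sym x y : f x y = 0 -> f y x = 0.
Proof. by move=> xy; rewrite (herm_sym hf) xy linear0 mulr0. Qed.

Definition in_span n (e : 'I_n -> P) (x : P) : Prop :=
  exists c : 'I_n -> A, x = \sum_i e i ** c i.

Lemma in_span_gen n (e : 'I_n -> P) i : in_span e (e i).
Proof.
exists (fun j => (j == i)%:R); rewrite (bigD1 i) //= eqxx scale1r big1 ?addr0 //.
by move=> j /negPf ->; rewrite scale0r.
Qed.

Lemma in_spanD n (e : 'I_n -> P) x y : in_span e x -> in_span e y -> in_span e (x + y).
Proof.
move=> [c ->] [d ->]; exists (fun i => c i + d i); rewrite -big_split.
by apply: eq_bigr => i _; exact: (esym (scalerDl (e i) (c i : A^c) (d i))).
Qed.

Lemma in_spanZ n (e : 'I_n -> P) x a : in_span e x -> in_span e (x ** a).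
Proof.
move=> [c ->]; exists (fun i => c i * a); rewrite scaler_sumr.
by apply: eq_bigr => i _; rewrite scalerA.
Qed.

Lemma in_span0 n (e : 'I_n -> P) : in_span e 0.
Proof. by exists (fun=> 0); rewrite big1 // => i _; rewrite scale0r. Qed.

Lemma in_span_sum n (e : 'I_n -> P) m (F : 'I_m -> P) :
  (forall i, in_span e (F i)) -> in_span e (\sum_i F i).
Proof.
by move=> eF; apply: big_ind => //; [exact: in_span0 | exact: in_spanD].
Qed.

Lemma in_span_trans n (e : 'I_n -> P) m (e' : 'I_m -> P) x :
  (forall i, in_span e (e' i)) -> in_span e' x -> in_span e x.
Proof. by move=> ee' [c ->]; apply: in_span_sum => i; apply: in_spanZ. Qed.

Definition cons_family x n (e : 'I_n -> P) : 'I_n.+1 -> P :=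
  fun i => if unlift ord0 i is Some j then e j else x.

Lemma cons_family0 x n (e : 'I_n -> P) : cons_family x e ord0 = x.
Proof. by rewrite /cons_family unlift_none. Qed.

Lemma cons_familyS x n (e : 'I_n -> P) j : cons_family x e (lift ord0 j) = e j.
Proof. by rewrite /cons_family liftK. Qed.

Lemma in_span_cons x n (e : 'I_n -> P) y : in_span (cons_family x e) y ->
  exists (a : A) z, in_span e z /\ y = x ** a + z.
Proof.
move=> [c ->]; exists (c ord0), (\sum_i e i ** c (lift ord0 i)); split.
  by exists (fun i => c (lift ord0 i)).
rewrite big_ord_recl cons_family0; congr (_ + _).
by apply: eq_bigr => i _; rewrite cons_familyS.
Qed.

(** Unimodularity on the span, phrased without submodules. It forces the [e j] to be independent:
    pair a relation with a [y] dual to [e j]. *)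
Definition nondegenerate n (e : 'I_n -> P) : Prop :=
  forall c : 'I_n -> A, exists2 y, in_span e y & forall j, f y (e j) = c j.

Definition unit_norm x : Prop := exists b, f x x * b = 1 /\ b * f x x = 1.

Hypothesis hR : semilocal R.
Hypothesis h2 : exists r : R, r * 2%:R = 1.
Hypothesis hdeg : forall p : prime_idealr R, symplectic_at p sigma eps ->
  even_degree_at A p.

Definition translate n (e : 'I_n.+1 -> P) (w : 'I_n -> A) : P :=
  e ord0 + \sum_j e (lift ord0 j) ** w j.

Lemma exists_unit_norm n (e : 'I_n.+1 -> P) : nondegenerate e ->
  exists w, unit_norm (translate e w).
Proof.
move=> nde.
(* Being dual to [e ord0], [y0] pairs to 1 with every vector of the coset at once. *)
have [y0 [c y0E] y0e] := nde (fun j => (j == ord0)%:R).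
have y0x w : f y0 (translate e w) = 1.
  rewrite (herm_addr hf) y0e eqxx herm_sumr big1 ?addr0 // => j _.
  by rewrite herm_scaler y0e mul0r.
have xy0 w : f (translate e w) y0 = eps.
  by rewrite (herm_sym hf) y0x sigma1 mulr1.
have epsV' : eps * sigma eps = 1 by rewrite heps.
have local (p : prime_idealr R) : maximal_ideal p -> exists w, exists b,
    to_fiber p (f (translate e w) (translate e w)) * to_fiber p b = 1 /\
    to_fiber p b * to_fiber p (f (translate e w) (translate e w)) = 1.
  move=> maxp.
  have [|||a [[w ->] [b ab]]] := @fiber_unit R A p maxp sigma eps
    (fun a => exists w, a = f (translate e w) (translate e w))
    (f (translate e (fun=> 0)) (translate e (fun=> 0)))
    h2 hA heps hepsV (@hdeg p); last by exists w, b.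
  - by exists (fun=> 0).
  - by move=> a [w ->]; exact: (herm_sym hf).
  move=> a [w ->]; set x := translate e w.
  (* Rewriting [y0] with [x] in place of [e ord0] leaves a remainder in the span of the other
     vectors. The factor [sigma eps] normalizes [f x y0 = eps] to 1, so
     [1 = f x x * (c ord0 * sigma eps) + f x v]. *)
  pose t j := (c (lift ord0 j) - w j * c ord0) * sigma eps.
  pose v := \sum_j e (lift ord0 j) ** t j.
  have y0v : y0 ** sigma eps = x ** (c ord0 * sigma eps) + v.
    rewrite y0E big_ord_recl /x /translate !scalerDr scalerA -addrA; congr (_ + _).
    rewrite !scaler_sumr -big_split; apply: eq_bigr => j _ /=.
    rewrite !scalerA -scalerDl; congr (_ *: _).
    have tE : t j + w j * (c ord0 * sigma eps) = c (lift ord0 j) * sigma eps.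
      by rewrite /t mulrBl mulrA subrK.
    by rewrite addrC; exact: (esym tE).
  exists (f x v), (f v v), (c ord0 * sigma eps); split.
    by rewrite -herm_scaler -(herm_addr hf) -y0v herm_scaler xy0.
  move=> b; exists (fun j => w j + t j * b).
  have -> : translate e (fun j => w j + t j * b) = x + v ** b.
    rewrite /x /translate -addrA; congr (_ + _); rewrite scaler_sumr -big_split.
    by apply: eq_bigr => j _; rewrite /= scalerDl scalerA.
  move: x y0v => x _.
  rewrite (herm_addl hf) !(herm_addr hf) (herm_sym hf (v ** b) x) !herm_scaler.
  by rewrite herm_scalel -!addrA.
have [N [m [r [maxm mP rP]]]] := semilocal_crt hR.
pose w i := projT1 (cid (local (m i) (maxm i))).
have wP i : exists b,
    to_fiber (m i) (f (translate e (w i)) (translate e (w i))) * to_fiber (m i) b = 1 /\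
    to_fiber (m i) b * to_fiber (m i) (f (translate e (w i)) (translate e (w i))) = 1.
  by rewrite /w; case: cid.
(* Chinese remainders: [translate e W] differs from [translate e (w i)] by a vector [D] with
   coefficients in [m i], which the form does not see in the fiber. *)
pose W j := \sum_i r i *: w i j.
exists W; apply: (fibers_inverse (azumaya_projective hA) (azumaya_separable hA)).
move=> I maxI; have [i mI] := mP I maxI; exists (m i) => //.
have [b ab] := wP i; exists b.
suff -> : to_fiber (m i) (f (translate e W) (translate e W)) =
    to_fiber (m i) (f (translate e (w i)) (translate e (w i))) by [].
pose z k := \sum_j e (lift ord0 j) ** w k j.
pose D := \sum_k z k ** ((r k - (k == i)%:R)%:A : A).
have WE : translate e W = translate e (w i) + D.
  have -> : translate e W = e ord0 + \sum_k z k ** (r k)%:A.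
    rewrite /translate; congr (_ + _); rewrite /z.
    under [RHS]eq_bigr do rewrite scaler_sumr.
    rewrite exchange_big; apply: eq_bigr => j _ /=; rewrite /W scaler_suml.
    apply: eq_bigr => k _; rewrite scalerA; congr (_ *: _).
    by rewrite -[RHS]/(w k j * (r k)%:A) -scalerAr mulr1.
  rewrite /translate -[X in _ = _ + X + _]/(z i) -addrA; congr (_ + _).
  have {1}-> : z i = \sum_k z k ** ((k == i)%:R : R)%:A.
    rewrite (bigD1 i) //= eqxx !scale1r big1 ?addr0 // => k /negPf ->.
    by rewrite !scale0r.
  rewrite /D -big_split; apply: eq_bigr => k _ /=.
  have -> : z k ** (r k)%:A = z k ** (((k == i)%:R)%:A + (r k - (k == i)%:R)%:A).
    by rewrite -scalerDl addrC subrK.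
  exact: scalerDl.
have z0 a k : to_fiber (m i) (((r k - (k == i)%:R) : R) *: a) = 0.
  rewrite to_fiberZ; have := rP k i; rewrite -res_eq0 => /eqP ->.
  by rewrite rmorph0 mul0r.
have fD x : to_fiber (m i) (f x D) = 0.
  rewrite herm_sumr to_fiber_sum big1 // => k _.
  by rewrite herm_scaler -scalerAr mulr1 z0.
have Df x : to_fiber (m i) (f D x) = 0.
  rewrite herm_suml to_fiber_sum big1 // => k _.
  by rewrite herm_scalel linearZ /= sigma1 -scalerAl mul1r z0.
rewrite WE; move: (translate e (w i)) => x.
by rewrite (herm_addl hf) !(herm_addr hf) !to_fiberD !fD !Df !addr0.
Qed.

Lemma orthogonal_family n (e : 'I_n -> P) : nondegenerate e ->
  exists e' : 'I_n -> P,
    [/\ forall i j, i != j -> f (e' i) (e' j) = 0, forall i, unit_norm (e' i),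
        forall i, in_span e (e' i) & forall i, in_span e' (e i)].
Proof.
elim: n e => [|n IHn] e nde.
  by exists e; split=> [[]|[]|[]|[]].
have [w [b [xb bx]]] := exists_unit_norm nde.
have tail_span c : in_span e (\sum_j e (lift ord0 j) ** c j).
  by apply: in_span_sum => j; apply: in_spanZ; apply: in_span_gen.
have ex : in_span e (translate e w).
  by apply: in_spanD; [exact: in_span_gen | exact: tail_span].
pose k j := - (b * f (translate e w) (e (lift ord0 j))).
pose e1 j := e (lift ord0 j) + translate e w ** k j.
have e1E j : e1 j = e (lift ord0 j) + translate e w ** k j by [].
have xe1 j : f (translate e w) (e1 j) = 0.
  by rewrite e1E (herm_addr hf) herm_scaler /k mulrN mulrA xb mul1r subrr.
have e_cons i : in_span (cons_family (translate e w) e1) (e i).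
  set F := cons_family _ _.
  have Fx : in_span F (translate e w).
    by rewrite -(cons_family0 (translate e w) e1); exact: in_span_gen.
  have Fe j : in_span F (e (lift ord0 j)).
    have -> : e (lift ord0 j) = e1 j + translate e w ** (- k j).
      by rewrite e1E -addrA -scalerDl [X in X *: _]subrr scale0r addr0.
    apply: in_spanD; last exact: in_spanZ.
    by rewrite -(cons_familyS (translate e w) e1); exact: in_span_gen.
  case: (unliftP ord0 i) => [j ->|->]; first exact: Fe.
  have -> : e ord0 = translate e w + (\sum_j e (lift ord0 j) ** w j) ** (-1).
    by rewrite /translate -[X in _ + _ + X]/((-1) *: _) scaleN1r addrK.
  by apply: in_spanD => //; apply: in_spanZ; apply: in_span_sum => j; exact: in_spanZ.
have nd1 : nondegenerate e1.
  (* The value at [e ord0] is chosen to make [y] orthogonal to [translate e w]. As that vector has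
     unit norm, [y] then has no component along it and lies in the span of [e1]. *)
  move=> c; pose c' i := if unlift ord0 i is Some j then c j else - \sum_j c j * w j.
  have [y ey yc] := nde c'.
  have yS j : f y (e (lift ord0 j)) = c j by rewrite yc /c' liftK.
  have yx : f y (translate e w) = 0.
    rewrite (herm_addr hf) herm_sumr yc /c' unlift_none.
    under [X in _ + X]eq_bigr do rewrite herm_scaler yS.
    exact: addNr.
  exists y; last first.
    by move=> j; rewrite e1E (herm_addr hf) herm_scaler yx mul0r addr0 yS.
  have [a [z [[d zE] yE]]] := in_span_cons (in_span_trans e_cons ey).
  suff a0 : a = 0 by rewrite yE a0 scale0r add0r; exists d.
  have := herm_orth_sym yx; rewrite yE (herm_addr hf) herm_scaler zE herm_sumr.
  rewrite big1 ?addr0 => [xa|j _]; last by rewrite herm_scaler xe1 mul0r.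
  by rewrite -[a]mul1r -bx -mulrA xa mulr0.
have [e' [orth unit e1e' e'e1]] := IHn e1 nd1.
have xe' j : f (translate e w) (e' j) = 0.
  have [c ->] := e1e' j; rewrite herm_sumr big1 // => i _.
  by rewrite herm_scaler xe1 mul0r.
have e'x j : f (e' j) (translate e w) = 0 by exact: herm_orth_sym.
exists (cons_family (translate e w) e'); split.
- move=> i j; case: (unliftP ord0 i) => [i' ->|->];
    case: (unliftP ord0 j) => [j' ->|->]; rewrite ?cons_familyS ?cons_family0 //.
  by rewrite (inj_eq lift_inj); apply: orth.
- move=> i; case: (unliftP ord0 i) => [i' ->|->].
    by rewrite cons_familyS.
  by rewrite cons_family0; exists b.
- move=> i; case: (unliftP ord0 i) => [i' ->|->]; last by rewrite cons_family0.
  rewrite cons_familyS; apply: in_span_trans (e1e' i') => j; rewrite e1E.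
  by apply: in_spanD; [exact: in_span_gen | exact: in_spanZ].
move=> i; apply: in_span_trans (e_cons i) => {}i.
have Fx : in_span (cons_family (translate e w) e') (translate e w).
  by rewrite -{2}(cons_family0 (translate e w) e'); exact: in_span_gen.
case: (unliftP ord0 i) => [i' ->|->]; last by rewrite cons_family0.
rewrite cons_familyS; apply: in_span_trans (e'e1 i') => j.
by rewrite -(cons_familyS (translate e w) e'); exact: in_span_gen.
Qed.

(** The finitely many basis vectors occurring in a finite generating family already span. *)
Lemma finite_basis : free_module P -> exists n (e : 'I_n -> P),
  (forall x, in_span e x) /\
  forall c : 'I_n -> A, \sum_i e i ** c i = 0 -> forall i, c i = 0.
Proof.
move=> [I [b [bspan bfree]]].
have [N [g gspan]] := herm_finitely_generated hf.
pose s k := projT1 (cid (bspan (g k))).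
have sP k : exists c : I -> A^c, g k = \sum_(i <- s k) c i *: b i.
  by rewrite /s; case: cid.
pose t := undup (flatten [seq s k | k <- enum 'I_N]).
pose e (i : 'I_(size t)) := b (tnth (in_tuple t) i).
have te i : i \in t -> in_span e (b i).
  by case/(tnthP (in_tuple t)) => j ->; exact: (in_span_gen e j).
exists (size t), e; split.
  move=> x; have [c ->] := gspan x.
  apply: in_span_sum => k; apply: in_spanZ; have [d ->] := sP k.
  rewrite big_seq; apply: (big_ind (in_span e)); [exact: in_span0|exact: in_spanD|].
  move=> i si; apply: in_spanZ; apply: te; rewrite mem_undup.
  by apply/flattenP; exists (s k) => //; apply: map_f; rewrite mem_enum.
move=> c c0 i.
pose c' (j : I) : A^c := if insub (index j t) is Some k then c k else 0.
have c'E k : c' (tnth (in_tuple t) k) = c k.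
  rewrite /c' (tnth_nth (tnth (in_tuple t) k)) /= index_uniq ?undup_uniq //.
  by rewrite valK.
have /bfree H : uniq t by exact: undup_uniq.
rewrite -c'E; apply: H; last exact: mem_tnth.
by rewrite big_tnth -[RHS]c0; apply: eq_bigr => k _; rewrite c'E.
Qed.

Theorem free_diagonalizable : free_module P -> diagonalizable_form sigma eps f.
Proof.
move=> /finite_basis[n [e [espan efree]]].
have nde : nondegenerate e.
  move=> c.
  pose crd x := projT1 (cid (espan x)).
  have crdE x : x = \sum_i e i ** crd x i by rewrite /crd; case: cid.
  have crd_uniq x (d : 'I_n -> A) : x = \sum_i e i ** d i -> forall i, crd x i = d i.
    move=> xd i; apply/eqP; rewrite -subr_eq0; apply/eqP.
    apply: (efree (fun i => crd x i - d i)).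
    transitivity ((\sum_i e i ** crd x i) - (\sum_i e i ** d i)).
      rewrite -sumrB; apply: eq_bigr => j _.
      exact: (scalerBl (crd x j : A^c) (d j) (e j)).
    by rewrite -crdE -xd subrr.
  (* The linear form with value [c j] at [e j]; unimodularity represents it by the required [y]. *)
  pose phi (x : P) : (A^c)^o := \sum_i c i * crd x i.
  have phi_lin : linear phi.
    move=> a x y; rewrite /phi.
    have -> : \sum_i c i * crd (a *: x + y) i =
        \sum_i (c i * crd x i * (a : A) + c i * crd y i).
      apply: eq_bigr => i _; rewrite (crd_uniq _ (fun i => crd x i * (a : A) + crd y i)).
        by rewrite mulrDr mulrA.
      rewrite {1}[x]crdE {1}[y]crdE scaler_sumr -big_split; apply: eq_bigr => j _ /=.
      by rewrite scalerA; exact: (esym (scalerDl _ _ _)).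
    by rewrite big_split -mulr_suml.
  pose phiL : {linear P -> (A^c)^o} :=
    HB.pack phi (GRing.isLinear.Build _ _ _ _ phi phi_lin).
  have [y [yphi _]] := herm_unimodular hf phiL.
  exists y; first exact: espan.
  move=> j; rewrite yphi /= /phi.
  have ej i : crd (e j) i = (i == j)%:R.
    apply: (crd_uniq _ (fun i => (i == j)%:R)).
    rewrite (bigD1 j) //= eqxx scale1r big1 ?addr0 // => k /negPf ->.
    by rewrite scale0r.
  rewrite (bigD1 j) //= ej eqxx mulr1 big1 ?addr0 // => i /negPf ij.
  by rewrite ej ij mulr0.
have [u [orth unit _ ue]] := orthogonal_family nde.
have uspan x : in_span u x by apply: in_span_trans (espan x).
pose inv i := projT1 (cid (unit i)).
have invP i : f (u i) (u i) * inv i = 1 /\ inv i * f (u i) (u i) = 1.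
  by rewrite /inv; case: cid.
have fu c i : f (u i) (\sum_j u j ** c j) = f (u i) (u i) * c i.
  rewrite herm_sumr (bigD1 i) //= big1 ?addr0 ?herm_scaler // => j ji.
  by rewrite herm_scaler orth ?mul0r // eq_sym.
exists n, (fun i => f (u i) (u i)); split=> [i|]; first exact: (herm_sym hf).
(* Fourier coefficients in the orthogonal family [u]; the diagonal entries are the invertible norms
   [f (u i) (u i)]. *)
pose phi (x : P) : {ffun 'I_n -> (A^c)^o} := [ffun i => inv i * f (u i) x].
have phi_lin : linear phi.
  move=> a x y; apply/ffunP => i; rewrite !ffunE (herm_addr hf).
  by rewrite (herm_scaler (u i) x a) mulrDr mulrA.
pose phiL : {linear P -> {ffun 'I_n -> (A^c)^o}} :=
  HB.pack phi (GRing.isLinear.Build _ _ _ _ phi phi_lin).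
pose psi (c : {ffun 'I_n -> (A^c)^o}) : P := \sum_i u i ** (c i : A).
have phiE x : x = psi (phi x).
  have [c {1 2}->] := uspan x; apply: eq_bigr => i _; rewrite ffunE fu mulrA.
  by rewrite (invP i).2 mul1r.
exists phiL; split.
  exists psi => [x|c]; first exact: (esym (phiE x)).
  by apply/ffunP => i; rewrite ffunE fu mulrA (invP i).2 mul1r.
move=> x y; rewrite {2}[x]phiE {2}[y]phiE herm_suml; apply: eq_bigr => i _.
by rewrite herm_scalel fu mulrA.
Qed.

End Hermitian.

Theorem proposition2p13 (R : comUnitRingType) (A : algType R)
    (sigma : {linear A -> A}) (eps : A) (P : lmodType A^c) (f : P -> P -> A)
    (hR : semilocal R) (h2 : (2%:R : R) \is a GRing.unit)
    (hA : azumaya_with_involution sigma)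
    (heps : in_center eps) (hepsV : sigma eps * eps = 1)
    (hf : unimodular_hermitian sigma eps f)
    (hP : free_module P)
    (hdeg : forall p : prime_idealr R, symplectic_at p sigma eps ->
       even_degree_at A p) :
  diagonalizable_form sigma eps f.
Proof.
apply: (free_diagonalizable hA heps hepsV hf hR _ hdeg hP).
by exists 2%:R^-1; rewrite mulVr.
Qed.
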